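(* There are universal constants $C_0,C_1,C>0$ such that the following holds. Let $n\ge5$, let $Q\subset\mathbb{R}^n$ be an unconditional convex body, let $r>0$ and $L\ge C_0r$. Then the diagonal $Q$-cone $K=K_{L,r}^{Q,\mathrm{cone}}$ contains the translate $\tfrac L2a_Q+\tfrac r8Q$ and is contained in $(L+r)Q$. Moreover, for every $0<s\le e^{-C_1n}$ there exist an integer $k$ with $\lceil n/3\rceil\le k\le\lfloor 2n/3\rfloor$ and a number $u>0$ such that, upon defining $$N_u(x)=\#\{i:x_i\ge uL(a_Q)_i\},\qquad A_u=\{x\in K:N_u(x)\le k-1\},$$ one has $$\frac{\operatorname{vol}(A_u)}{\operatorname{vol}(K)}=s\qquad\text{and}\qquad\frac{\operatorname{vol}(\partial_0^KA_u)}{\operatorname{vol}(A_u)}\le\frac{Cr}{L}.$$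
   Context: A convex body $Q\subset\mathbb{R}^n$ (compact, convex, nonempty interior) is unconditional if it is invariant under arbitrary sign changes of the coordinates; its norm is $\|z\|_Q=\inf\{a>0:z\in aQ\}$. For a symmetric convex body $B$ and a linear functional $\varphi$, $\|\varphi\|_{B^*}=\sup_{x\in B}|\varphi(x)|$. For Borel $S\subset K$, $\partial_0^KS$ is the set of $y\in K\setminus S$ for which some $x\in S$ differs from $y$ in at most one coordinate. Construction of the cone. Let $\sigma_i(Q)^2=\frac1{\operatorname{vol}(Q)}\int_Qx_i^2\,dx$, $\Lambda_Q=\operatorname{diag}(\sigma_1(Q)^{-1},\dots,\sigma_n(Q)^{-1})$, $\widehat Q=\Lambda_QQ$. Let $\mathbf 1=(1,\dots,1)$, $q_Q=\|\mathbf 1\|_{\widehat Q}$, $\widehat a_Q=q_Q^{-1}\mathbf 1$. Choose a linear functional $\widehat\ell_Q$ with $\|\widehat\ell_Q\|_{\widehat Q^*}=1$ and $\widehat\ell_Q(\widehat a_Q)=1$. Set $a_Q=\Lambda_Q^{-1}\widehat a_Q$, $\ell_Q=\widehat\ell_Q\circ\Lambda_Q$, $H_Q=\ker\ell_Q$, $F_Q=Q\cap H_Q$. Then $$K_{L,r}^{Q,\mathrm{cone}}=\operatorname{conv}\bigl(\{0\}\cup(La_Q+rF_Q)\bigr).$$ *)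

(* Defs.v *)
From HB Require Import structures.
From mathcomp Require Import all_boot all_order all_algebra.
From mathcomp Require Import all_classical all_reals all_analysis.

Set Implicit Arguments.
Unset Strict Implicit.
Unset Printing Implicit Defensive.
Import Order.TTheory GRing.Theory Num.Theory.
Import numFieldNormedType.Exports.
Local Open Scope classical_set_scope.
Local Open Scope ring_scope.

(* The library has Lebesgue measure on R and products of two measures, but no
   measure on 'rV[R]_n.  Here R^n carries the Borel sigma-algebra, in the form
   of the sigma-algebra generated by the coordinates, and the n-dimensional
   Lebesgue measure is the n-fold product, taken along R x R^n ~ R^(1+n).     *)
Section measurable_rV.
Variables (R : realType) (n : nat).

Definition rV_coord (i : 'I_n) (x : 'rV[R]_n) : R := x ord0 i.

Let rV_set0 : g_sigma_preimage rV_coord set0.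
Proof. exact: sigma_algebra0. Qed.

Let rV_setC A : g_sigma_preimage rV_coord A -> g_sigma_preimage rV_coord (~` A).
Proof. exact: sigma_algebraC. Qed.

Let rV_bigcup (F : (set 'rV[R]_n)^nat) :
  (forall i, g_sigma_preimage rV_coord (F i)) ->
  g_sigma_preimage rV_coord (\bigcup_i (F i)).
Proof. exact: sigma_algebra_bigcup. Qed.

HB.instance Definition _ := @isMeasurable.Build default_measure_display
  'rV[R]_n (g_sigma_preimage rV_coord) rV_set0 rV_setC rV_bigcup.

Lemma measurable_rV_coord (i : 'I_n) : measurable_fun setT (rV_coord i).
Proof.
move=> _ Y mY; rewrite setTI; apply: sub_sigma_algebra => /=.
rewrite -bigcup_seq/=; exists i => /=; first by rewrite mem_index_enum.
by exists Y => //; rewrite setTI.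
Qed.

Lemma measurable_fun_rV d (T : measurableType d) (f : T -> 'rV[R]_n) :
  (forall i, measurable_fun setT (rV_coord i \o f)) -> measurable_fun setT f.
Proof.
move=> mf _ Y; rewrite setTI.
have sub : g_sigma_preimage rV_coord `<=` [set Y | measurable (f @^-1` Y)].
  apply: smallest_sub.
    split=> [|A mA|F mF] /=.
    - by rewrite preimage_set0.
    - by rewrite setTD preimage_setC; exact: measurableC.
    - by rewrite preimage_bigcup; by apply: bigcup_measurable => k _; exact: mF.
  rewrite -bigcup_seq; apply: bigcup_sub => i _ A [B mB <-] /=.
  by have := mf i measurableT B mB; rewrite !setTI.
exact: sub.
Qed.

End measurable_rV.

Section rV_cons.
Variables (R : realType) (n : nat).

Definition rV_cons (p : measurableTypeR R * 'rV[R]_n) : 'rV[R]_n.+1 :=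
  row_mx (const_mx p.1 : 'rV_1) p.2.

Lemma measurable_rV_cons : measurable_fun setT rV_cons.
Proof.
apply: measurable_fun_rV => i.
case: (split_ordP (i : 'I_(1 + n))) => j ->.
  have -> : rV_coord (lshift n j) \o rV_cons = fst.
    by apply/funext => p; rewrite /= /rV_coord [LHS]row_mxEl mxE.
  exact: measurable_fst.
have -> : rV_coord (rshift 1 j) \o rV_cons = rV_coord j \o snd.
  by apply/funext => p; rewrite /= /rV_coord [LHS]row_mxEr.
exact: (measurableT_comp (measurable_rV_coord j) measurable_snd).
Qed.

Variable mu : {sigma_finite_measure set 'rV[R]_n -> \bar R}.

Definition lebesgue_rVS : set 'rV[R]_n.+1 -> \bar R :=
  pushforward (@lebesgue_measure R \x mu)%E rV_cons.

Let lebesgue_rVS0 : lebesgue_rVS set0 = 0%E.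
Proof. by rewrite /lebesgue_rVS /pushforward preimage_set0 measure0. Qed.

Let lebesgue_rVS_ge0 A : (0 <= lebesgue_rVS A)%E.
Proof. exact: (measure_ge0 (@lebesgue_measure R \x mu)%E). Qed.

Let lebesgue_rVS_sigma_additive : semi_sigma_additive lebesgue_rVS.
Proof.
exact: (@measure_semi_sigma_additive _ _ _
  (measure_function_pushforward__canonical__measure_function_Measure
     (@lebesgue_measure R \x mu)%E measurable_rV_cons)).
Qed.

HB.instance Definition _ := isMeasure.Build _ _ _ lebesgue_rVS
  lebesgue_rVS0 lebesgue_rVS_ge0 lebesgue_rVS_sigma_additive.

Let lebesgue_rVS_sigma_finite : sigma_finite setT lebesgue_rVS.
Proof.
have [F TF Ffin] : sigma_finite setT (@lebesgue_measure R \x mu)%E.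
  have /sigma_finiteP[F [TF ndF Foo]] := sigma_finiteT (@lebesgue_measure R).
  have /sigma_finiteP[G [TG ndG Goo]] := sigma_finiteT mu.
  exists (fun k => F k `*` G k).
    rewrite -setXTT TF TG; apply/seteqP; split=> [[x y] /=|[x y] [k _ /= []]].
      move=> [[k _ Fkx] [l _ Gly]]; exists (maxn k l) => //; split.
        by move: x Fkx; exact/subsetPset/ndF/leq_maxl.
      by move: y Gly; exact/subsetPset/ndG/leq_maxr.
    by move=> Fkx Gky; split; exists k.
  move=> k; have [mF Fk] := Foo k; have [mG Gk] := Goo k.
  split; first exact: measurableX.
  by rewrite product_measure1E// lte_mul_pinfty// ge0_fin_numE.
pose tl (v : 'rV[R]_n.+1) : 'rV[R]_n := rsubmx (v : 'rV_(1 + n)).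
pose g (v : 'rV[R]_n.+1) : measurableTypeR R * 'rV[R]_n :=
  (rV_coord (lshift n ord0 : 'I_(1 + n)) v, tl v).
have mg : measurable_fun [set: 'rV[R]_n.+1] g.
  apply: measurable_fun_pair; first exact: measurable_rV_coord.
  apply: measurable_fun_rV => i.
  have -> : rV_coord i \o tl = rV_coord (rshift 1 i : 'I_(1 + n)).
    by apply/funext => v; rewrite /= /rV_coord [LHS]mxE.
  exact: measurable_rV_coord.
have gK p : g (rV_cons p) = p.
  case: p => x v; congr pair; last exact: row_mxKr.
  by rewrite /rV_coord [LHS]row_mxEl mxE.
exists (fun k => g @^-1` F k).
  by rewrite -preimage_bigcup -TF.
move=> k; have [mF Fk] := Ffin k; split.
  by rewrite -[X in measurable X]setTI; exact: mg.
rewrite /lebesgue_rVS /pushforward.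
suff -> : rV_cons @^-1` (g @^-1` F k) = F k by [].
by apply/seteqP; split=> p /=; rewrite gK.
Qed.

HB.instance Definition _ := Measure_isSigmaFinite.Build _ _ _ lebesgue_rVS
  lebesgue_rVS_sigma_finite.

End rV_cons.

Fixpoint lebesgue_rV (R : realType) (n : nat) :
    {sigma_finite_measure set 'rV[R]_n -> \bar R} :=
  if n is m.+1 then
    [the {sigma_finite_measure set _ -> \bar R} of
       lebesgue_rVS (lebesgue_rV R m)]
  else [the {sigma_finite_measure set _ -> \bar R} of \d_(0 : 'rV[R]_0)].

Lemma lebesgue_rV_box (R : realType) (n : nat)
    (F : 'I_n -> set (measurableTypeR R)) : (forall i, measurable (F i)) ->
  lebesgue_rV R n [set x | forall i, F i (x ord0 i)] =
  (\prod_(i < n) lebesgue_measure (F i))%E.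
Proof.
elim: n F => [|n IHn] F mF /=.
  rewrite big_ord0 diracE mem_set//; last by case.
rewrite big_ord_recl -IHn => [|i]; last exact: mF.
pose G := [set v : 'rV[R]_n | forall i, F (lift ord0 i) (v ord0 i)].
have mG : measurable G.
  have -> : G = \bigcap_i (rV_coord i @^-1` F (lift ord0 i)).
    by apply/seteqP; split=> [v Gv i _|v Gv i]; [exact: Gv|exact: (Gv i I)].
  apply: fin_bigcap_measurable => // i _; rewrite -[X in measurable X]setTI.
  by apply: measurable_rV_coord => //; exact: mF.
rewrite /lebesgue_rVS /pushforward -[RHS]product_measure1E//.
congr (_ _); apply/seteqP; split=> -[x v] /=.
  move=> Fxv; split=> [|i].
    have := Fxv ord0; rewrite (_ : ord0 = lshift n (ord0 : 'I_1)); last exact: val_inj.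
    by rewrite [rV_cons _ _ _]row_mxEl mxE.
  have := Fxv (lift ord0 i); rewrite (_ : lift ord0 i = rshift 1 i); last exact: val_inj.
  by rewrite [rV_cons _ _ _]row_mxEr.
move=> [Fx Fv] i; case: (unliftP ord0 i) => [j|] ->.
  rewrite (_ : rV_cons _ _ _ = v ord0 j) //.
  rewrite (_ : lift ord0 j = rshift 1 j) ?[LHS]row_mxEr//; exact: val_inj.
rewrite (_ : rV_cons _ _ _ = x) //.
rewrite (_ : ord0 = lshift n (ord0 : 'I_1)) ?[LHS]row_mxEl ?mxE//; exact: val_inj.
Qed.

Section cone.
Variables (R : realType) (n : nat).
Implicit Types (Q B K S : set 'rV[R]_n) (x y z : 'rV[R]_n) (L r : R).

(* [fine] maps +oo to 0; this is the volume for Borel sets of finite measure. *)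
Definition vol S : R := fine (lebesgue_rV R n S).

Definition convex_body Q : Prop :=
  [/\ compact Q, @convex_set R 'rV[R]_n Q & interior Q !=set0].

Definition sign_change (e : 'I_n -> bool) x : 'rV[R]_n :=
  \row_i ((-1) ^+ e i * x ord0 i).

Definition unconditional Q : Prop := forall e, sign_change e @` Q = Q.

Definition body_norm Q z : R :=
  inf [set a : R | 0 < a /\ exists2 x, Q x & z = a *: x].

Definition dual_norm B (phi : {scalar 'rV[R]_n}) : R :=
  sup [set `|phi x| | x in B].

Definition coord_boundary K S : set 'rV[R]_n :=
  [set y | [/\ K y, ~ S y &
    exists2 x, S x & (#|[pred i | x ord0 i != y ord0 i]| <= 1)%N]].

Definition sigma Q (i : 'I_n) : R :=
  Num.sqrt ((vol Q)^-1 * \int[lebesgue_rV R n]_(x in Q) (x ord0 i ^+ 2)).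

(* Vectors are rows, so matrices act on the right. *)
Definition Lambda Q : 'M[R]_n := diag_mx (\row_i (sigma Q i)^-1).

Definition hat Q : set 'rV[R]_n := [set x *m Lambda Q | x in Q].

Definition hat_apex Q : 'rV[R]_n :=
  (body_norm (hat Q) (const_mx 1))^-1 *: const_mx 1.

(* The admissible choices of the functional; it need not be unique, and the
   notions below take the chosen one as an argument. *)
Definition norming Q (lhat : {scalar 'rV[R]_n}) : Prop :=
  dual_norm (hat Q) lhat = 1 /\ lhat (hat_apex Q) = 1.

Definition apex Q : 'rV[R]_n := hat_apex Q *m invmx (Lambda Q).

Definition ell Q (lhat : {scalar 'rV[R]_n}) x : R := lhat (x *m Lambda Q).

Definition central_section Q (lhat : {scalar 'rV[R]_n}) : set 'rV[R]_n :=
  Q `&` [set x | ell Q lhat x = 0].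

Definition convex_hull S : set 'rV[R]_n := smallest (@convex_set R 'rV[R]_n) S.

Definition diagonal_cone Q (lhat : {scalar 'rV[R]_n}) L r : set 'rV[R]_n :=
  convex_hull
    ([set 0] `|` [set L *: apex Q + r *: y | y in central_section Q lhat]).

Definition count_ge Q L (u : R) x : nat :=
  #|[pred i | u * L * apex Q ord0 i <= x ord0 i]|.

End cone.

(* Main.v *)
Require Import Defs.
From HB Require Import structures.
From mathcomp Require Import all_boot all_order all_algebra fingroup perm.
From mathcomp Require Import all_classical all_reals all_analysis.
From mathcomp Require Import measurable_realfun ring lra zify.

(* Write eps = D r / L.  The heart of the matter is that for every f in Q fewer than
   n/3 coordinates satisfy |f_i| >= D a_i, with D universal.  Hence, for
   x = t (L a + r f) in the cone and n/3 <= k <= 2n/3, the k-th largest ratio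
   x_i / (L a_i) lies between t (1 - eps) and t (1 + eps), and the sets
   {N_(1 - eps) <= k - 1} all have volume between
   ((1 - eps) / (1 + eps))^n vol K and vol K.  These volumes increase with k, so for
   some k the ratio of two consecutive ones is at most ((1 + eps) / (1 - eps))^4.
   For u = c (1 - eps), c <= 1, the set A_u is the dilate by c of the one for c = 1,
   so its volume is prescribed by choosing c; its boundary lies in {N_u = k}, the
   difference of two consecutive dilated sets.

   For the claim on f, let sigma_i^2 be the mean of x_i^2 over Q and a = p sigma.
   The norming functional is sum_i b_i x_i with b_i >= 0 and sum_i b_i |x_i| <= 1 on
   Q; averaging over Q and using that the mean of |x_i| is at least c sigma_i bounds p
   from below.  This reverse Hoelder inequality comes from the log-concavity of the
   marginals, i.e. from Prekopa's inequality, which for sets closed under decreasing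
   the |x_i| has an easy proof by induction on the dimension since all one-dimensional
   level sets are symmetric intervals.  Finally vol Q <= 6^n prod_i sigma_i by
   comparison with a Gaussian, whereas Q contains the box with sides |f_i| + a_i. *)

Set Implicit Arguments.
Unset Strict Implicit.
Unset Printing Implicit Defensive.
Import Order.TTheory GRing.Theory Num.Theory.
Import numFieldNormedType.Exports.
Local Open Scope classical_set_scope.
Local Open Scope ring_scope.

(** * Lebesgue measure on row vectors *)

Section rV_measure.
Variable R : realType.
Local Notation lam := (@lebesgue_measure R).

Definition rV_box n (F : 'I_n -> set (measurableTypeR R)) : set 'rV[R]_n :=
  [set x | forall i, F i (x ord0 i)].

Lemma measurable_rV_box n (F : 'I_n -> set (measurableTypeR R)) :
  (forall i, measurable (F i)) -> measurable (rV_box F).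
Proof.
move=> mF.
have -> : rV_box F = \bigcap_i (@rV_coord R n i @^-1` F i).
  by apply/seteqP; split=> [v Gv i _|v Gv i]; [exact: Gv|exact: (Gv i I)].
apply: fin_bigcap_measurable => // i _; rewrite -[X in measurable X]setTI.
by apply: measurable_rV_coord => //; exact: mF.
Qed.

Lemma lebesgue_rV_boxE n (F : 'I_n -> set (measurableTypeR R)) :
  (forall i, measurable (F i)) ->
  lebesgue_rV R n (rV_box F) = (\prod_(i < n) lam (F i))%E.
Proof. exact: lebesgue_rV_box. Qed.

Lemma lebesgue_rV_cube_lty n (k : R) :
  (lebesgue_rV R n (rV_box (fun=> `[(- k)%R, k]%classic)) < +oo)%E.
Proof.
rewrite lebesgue_rV_boxE//; under eq_bigr do rewrite lebesgue_measure_itv/=.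
under eq_bigr do rewrite -EFinB -[X in if _ then _ else X]/(0%:E) -fun_if.
by rewrite prodEFin ltry.
Qed.

(** Boxes form an intersection-stable generator of the sigma-algebra, and cubes of finite measure
    exhaust the space. The effect of dilations and of coordinate permutations on volume is thereby
    read off from boxes. *)
Lemma rV_measure_unique n (mu : {measure set 'rV[R]_n -> \bar R}) :
  (forall F : 'I_n -> set (measurableTypeR R), (forall i, measurable (F i)) ->
    mu (rV_box F) = (\prod_(i < n) lam (F i))%E) ->
  forall A, measurable A -> lebesgue_rV R n A = mu A.
Proof.
move=> mubox.
pose G : set (set 'rV[R]_n) := [set B | exists F : 'I_n -> set (measurableTypeR R),
  (forall i, measurable (F i)) /\ B = rV_box F].
apply: (measure_unique G
  (fun k => rV_box (fun=> `](- k%:R), k%:R[%classic))).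
- rewrite /measurable/= /g_sigma_preimage; apply/seteqP; split.
    apply: smallest_sub; first exact: smallest_sigma_algebra.
    rewrite -bigcup_seq; apply: bigcup_sub => i _ A [B mB <-].
    rewrite setTI; apply: sub_sigma_algebra.
    exists (fun j => if j == i then B else setT); split=> [j|].
      by case: ifP.
    apply/seteqP; split=> x /=; rewrite /rV_coord.
      by move=> Bx j; case: eqP => // ->.
    by move=> /(_ i); rewrite eqxx.
  apply: smallest_sub; first exact: (@sigma_algebra_measurable _ 'rV[R]_n).
  by move=> _ [F [mF ->]]; exact: measurable_rV_box.
- move=> _ _ [F [mF ->]] [F' [mF' ->]]; exists (fun i => F i `&` F' i); split.
    by move=> i; exact: measurableI.
  apply/seteqP; split=> x /=; first by move=> [h h'] i; split.
  by move=> h; split=> i; case: (h i).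
- by move=> k; exists (fun=> `](- k%:R), k%:R[%classic); split.
- apply/seteqP; split=> // x _.
  exists (Num.truncn (\sum_i `|x ord0 i|)).+1 => //= i.
  rewrite /= in_itv/= -ltr_norml; apply: le_lt_trans (truncnS_gt _).
  by rewrite (bigD1 i)//= lerDl sumr_ge0.
- by move=> _ [F [mF ->]]; rewrite mubox//; exact: lebesgue_rV_boxE.
- move=> k; apply: le_lt_trans (lebesgue_rV_cube_lty n k%:R).
  apply: le_measure; rewrite ?inE; [exact: measurable_rV_box..|].
  move=> x /= h i; apply: subset_itvW (h i) => //.
Qed.

Lemma lebesgue_measure_dilate (c : R) (A : set (measurableTypeR R)) : 0 < c ->
  measurable A -> lam A = (c%:E * lam ((fun x : R => c * x)%R @^-1` A))%E.
Proof.
move=> c0 mA.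
have mc : measurable_fun setT ((fun x : R => c * x)%R : measurableTypeR R -> measurableTypeR R).
  exact: measurable_funM.
pose m1 := measure_function_pushforward__canonical__measure_function_Measure lam mc.
have := (@lebesgue_measure_unique R (mscale (NngNum (ltW c0)) m1)).
apply => // _ [[a b]/= _ <-].
rewrite /mscale/= /pushforward.
have -> : (fun x : R => c * x) @^-1` `]a, b] = `]c^-1 * a, c^-1 * b]%classic.
  apply/seteqP; split=> x /=; rewrite !in_itv/= ![c^-1 * _]mulrC;
  by rewrite ltr_pdivrMr// ler_pdivlMr// mulrC.
rewrite !lebesgue_measure_itv/= !lte_fin ltr_pM2l ?invr_gt0//.
case: ifP => _; last by rewrite mule0.
by rewrite -!EFinD -EFinM -mulrBr mulrA divff ?mul1r// gt_eqF.
Qed.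

End rV_measure.

Section rV_measure2.
Variable R : realType.
Local Notation lam := (@lebesgue_measure R).

Lemma measurable_rV_coord_fun n (i : 'I_n) :
  measurable_fun setT (fun x : 'rV[R]_n => x ord0 i : measurableTypeR R).
Proof. exact: (measurable_rV_coord i). Qed.

Lemma measurable_rV_scale n (c : R) :
  measurable_fun setT (fun x : 'rV[R]_n => c *: x).
Proof.
apply: measurable_fun_rV => i.
have -> : rV_coord i \o (fun x : 'rV[R]_n => c *: x) =
    (fun x => c * x ord0 i) by apply/funext => x; rewrite /= /rV_coord mxE.
by apply: measurable_funM => //; exact: measurable_rV_coord_fun.
Qed.

Lemma lebesgue_rV_dilate n (c : R) (A : set 'rV[R]_n) : 0 < c -> measurable A ->
  lebesgue_rV R n A =
  ((c ^+ n)%:E * lebesgue_rV R n ((fun x : 'rV[R]_n => c *: x) @^-1` A))%E.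
Proof.
move=> c0 mA.
pose m1 := measure_function_pushforward__canonical__measure_function_Measure
  (lebesgue_rV R n) (measurable_rV_scale c).
have := @rV_measure_unique R n (mscale (NngNum (exprn_ge0 n (ltW c0))) m1).
apply => // F mF.
change ((c ^+ n)%:E * lebesgue_rV R n ((fun x : 'rV[R]_n => c *: x) @^-1` rV_box F) =
  \prod_(i < n) lam (F i))%E.
rewrite [X in lebesgue_rV R n X](_ : _ =
    rV_box (fun i => ((fun x : R => c * x)%R @^-1` F i))); last first.
  by apply/seteqP; split=> x /= h i; have := h i; rewrite /= mxE.
rewrite lebesgue_rV_boxE; last first.
  move=> i; rewrite -[X in measurable X]setTI.
  have mc : measurable_fun setT ((fun x : R => c * x)%R : measurableTypeR R -> measurableTypeR R).
    exact: measurable_funM.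
  exact: mc.
under [RHS]eq_bigr do rewrite (lebesgue_measure_dilate c0)//.
by rewrite big_split/= prodEFin prodr_const card_ord.
Qed.

Lemma lebesgue_rV_scale n (c : R) (A : set 'rV[R]_n) : 0 < c -> measurable A ->
  lebesgue_rV R n [set c *: x | x in A] = ((c ^+ n)%:E * lebesgue_rV R n A)%E.
Proof.
move=> c0 mA.
have pre (B : set 'rV[R]_n) : [set c *: x | x in B] = (fun x => c^-1 *: x) @^-1` B.
  apply/seteqP; split=> x /=.
    by move=> [y By <-]; rewrite scalerA mulVf ?scale1r// gt_eqF.
  by move=> Bx; exists (c^-1 *: x) => //; rewrite scalerA mulfV ?scale1r// gt_eqF.
have mcA : measurable [set c *: x | x in A].
  rewrite pre -[X in measurable X]setTI; exact: measurable_rV_scale.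
rewrite (lebesgue_rV_dilate c0 mcA) pre -comp_preimage/=; congr (_ * lebesgue_rV R n _)%E.
apply/seteqP; split=> x /=; by rewrite scalerA mulVf ?scale1r// gt_eqF.
Qed.

Lemma measurable_col_perm n (s : 'S_n) :
  measurable_fun setT (col_perm s : 'rV[R]_n -> 'rV[R]_n).
Proof.
apply: measurable_fun_rV => i.
have -> : rV_coord i \o (col_perm s : 'rV[R]_n -> _) = (fun x => x ord0 (s i)).
  by apply/funext => x; rewrite /= /rV_coord mxE.
exact: measurable_rV_coord_fun.
Qed.

Lemma lebesgue_rV_perm n (s : 'S_n) (A : set 'rV[R]_n) : measurable A ->
  lebesgue_rV R n (col_perm s @^-1` A) = lebesgue_rV R n A.
Proof.
move=> mA.
pose m1 := measure_function_pushforward__canonical__measure_function_Measure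
  (lebesgue_rV R n) (measurable_col_perm s).
apply/esym; apply: (@rV_measure_unique R n m1) => // F mF.
change (lebesgue_rV R n (col_perm s @^-1` rV_box F) = \prod_(i < n) lam (F i))%E.
rewrite [X in lebesgue_rV R n X](_ : _ = rV_box (fun i => F (s^-1%g i))); last first.
  apply/seteqP; split=> x /= h i.
    by have := h (s^-1%g i); rewrite /= mxE permKV.
  by rewrite mxE; have := h (s i); rewrite /= permK.
rewrite lebesgue_rV_boxE// [RHS](reindex_inj (@perm_inj _ s^-1%g))//.
Qed.

(** The complement is open, hence the union of the cubes with rational centre and radius
    [1 / (k + 1)] that it contains; these are countably many, enumerated by [pickle]. *)
Lemma closed_measurable_rV n (A : set 'rV[R]_n) : closed A -> measurable A.
Proof.
rewrite -openC => oA; rewrite -[A]setCK; apply: measurableC.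
set U := ~` A in oA *; move: U oA => U oU {A}.
pose B (q : 'rV[rat]_n * nat) : set 'rV[R]_n :=
  rV_box (fun i => ball (ratr (q.1 ord0 i) : R) q.2.+1%:R^-1).
have -> : U = \bigcup_k (if unpickle k is Some q then
     if `[< B q `<=` U >] then B q else set0 else set0).
  apply/seteqP; split=> x; last first.
    by move=> [k _]; case: unpickle => // q; case: asboolP => // BU; exact: BU.
  move=> Ux; have /nbhs_ballP[e /= e0 xeU] := open_nbhs_nbhs (conj oU Ux).
  have [m em] : exists m : nat, m.+1%:R^-1 < e / 2.
    exists (Num.truncn (e / 2)^-1); rewrite invf_plt ?posrE ?divr_gt0 ?ltr0n//.
    exact: truncnS_gt.
  have qP i : exists q : rat, `|x ord0 i - ratr q| < m.+1%:R^-1.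
    have : x ord0 i < x ord0 i + m.+1%:R^-1 by rewrite ltrDl invr_gt0 ltr0n.
    move=> /rat_in_itvoo[q /itvP h]; exists q.
    by rewrite distrC gtr0_norm ?subr_gt0 ?h// ltrBlDl h.
  pose q : 'rV[rat]_n := \row_i projT1 (cid (qP i)).
  have qE i : `|x ord0 i - ratr (q ord0 i)| < m.+1%:R^-1.
    by rewrite mxE; case: cid.
  exists (pickle (q, m)) => //; rewrite pickleK; case: asboolP.
    by move=> _ i; rewrite /ball/= distrC.
  move=> []; move=> y By; apply: xeU; split=> // i j; rewrite ord1 /ball/=.
  have /= := By j; rewrite /ball/= => qy; have := qE j => xq.
  have : `|x ord0 j - y ord0 j| <= `|x ord0 j - ratr (q ord0 j)| + `|ratr (q ord0 j) - y ord0 j|.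
    exact: ler_distD.
  by move: qy xq em; set z := _^-1; lra.
apply: bigcupT_measurable => k; case: unpickle => // q; case: asboolP => // _.
by apply: measurable_rV_box => i; exact: measurable_ball.
Qed.

Definition rV_slice n (A : set 'rV[R]_n.+1) (t : R) : set 'rV[R]_n :=
  [set v | A (rV_cons (t : measurableTypeR R, v))].

Lemma measurable_rV_slice n (A : set 'rV[R]_n.+1) (t : R) : measurable A ->
  measurable (rV_slice A t).
Proof.
move=> mA.
have mp : measurable_fun setT (fun v : 'rV[R]_n => rV_cons (t : measurableTypeR R, v)).
  apply: measurableT_comp; first exact: measurable_rV_cons.
  exact: measurable_pair1.
by rewrite -[X in measurable X]setTI; exact: mp.
Qed.

Lemma rV_cons0 n (t : R) (v : 'rV[R]_n) : rV_cons (t : measurableTypeR R, v) ord0 ord0 = t.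
Proof.
by rewrite (_ : ord0 = lshift n (ord0 : 'I_1)) ?[LHS]row_mxEl ?mxE//; exact: val_inj.
Qed.

Lemma rV_consS n (t : R) (v : 'rV[R]_n) i :
  rV_cons (t : measurableTypeR R, v) ord0 (lift ord0 i) = v ord0 i.
Proof.
by rewrite (_ : lift ord0 i = rshift 1 i) ?[LHS]row_mxEr//; exact: val_inj.
Qed.

Lemma ge0_integral_rV_cons n (f : 'rV[R]_n.+1 -> \bar R) :
  measurable_fun setT f -> (forall x, 0 <= f x)%E ->
  (\int[lebesgue_rV R n.+1]_x f x =
   \int[lam]_t \int[lebesgue_rV R n]_v f (rV_cons (t : measurableTypeR R, v)))%E.
Proof.
move=> mf f0.
rewrite [LHS](@ge0_integral_pushforward _ _ _ _ _ _ (@measurable_rV_cons R n)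
  (lam \x lebesgue_rV R n)%E setT f measurableT)//.
rewrite preimage_setT.
rewrite (@fubini_tonelli1 _ _ _ _ _ lam (lebesgue_rV R n) (f \o @rV_cons R n))//.
  by apply: measurableT_comp => //; exact: measurable_rV_cons.
by move=> x; exact: f0.
Qed.

Lemma lebesgue_rV_slice n (A : set 'rV[R]_n.+1) :
  lebesgue_rV R n.+1 A = (\int[lam]_t lebesgue_rV R n (rV_slice A t))%E.
Proof.
rewrite [LHS]/= /lebesgue_rVS /pushforward /product_measure1.
apply: eq_integral => t _ /=; congr (lebesgue_rV R n _).
by apply/seteqP; split=> v; rewrite /xsection/= inE.
Qed.

Lemma measurable_fun_slice n (A : set 'rV[R]_n.+1) : measurable A ->
  measurable_fun setT (fun t : measurableTypeR R => lebesgue_rV R n (rV_slice A t)).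
Proof.
move=> mA.
have mB : measurable (@rV_cons R n @^-1` A).
  by rewrite -[X in measurable X]setTI; exact: measurable_rV_cons.
have := measurable_fun_xsection (lebesgue_rV R n) mB.
congr (measurable_fun _ _); apply/funext => t /=; congr (lebesgue_rV R n _).
by apply/seteqP; split=> v; rewrite /xsection/= inE.
Qed.

End rV_measure2.

(** * A Prekopa inequality for solid sets *)

Section prekopa.
Variable R : realType.
Local Notation lam := (@lebesgue_measure R).
Local Notation gR := (measurableTypeR R).

Let hypo (f : gR -> R) : set (gR * gR) := [set p | 0 <= p.2 < f p.1].

Let measurable_hypo (f : gR -> R) : measurable_fun setT f -> measurable (hypo f).
Proof.
move=> mf.
have -> : hypo f = (fun p : gR * gR => 0 <= (p.2 : R)) @^-1` [set true] `&`
    (fun p : gR * gR => (p.2 : R) < f p.1) @^-1` [set true].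
  by apply/seteqP; split=> p /= => [/andP|[? ?]]; last exact/andP.
apply: measurableI; rewrite -[X in measurable X]setTI.
  by apply: (measurable_fun_ler (f := cst 0)).
apply: measurable_fun_ltr => //; exact: measurableT_comp.
Qed.

Let hypo_ysection (f : gR -> R) s :
  ysection (hypo f) s = [set x : gR | (0 <= s < f x)%R].
Proof. by apply/seteqP; split=> x; rewrite /ysection/= inE. Qed.

(** Tonelli for the hypograph of [f], measured along vertical and then along horizontal sections.
    The latter are empty at heights [s < 0], so [s] may run over the whole line. *)
Lemma layer_cake (f : gR -> R) : measurable_fun setT f -> (forall x, 0 <= f x) ->
  (\int[lam]_x (f x)%:E = \int[lam]_s lam [set x : gR | (0 <= s < f x)%R])%E.
Proof.
move=> mf f0; have mP := measurable_hypo mf; set P := hypo f in mP.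
transitivity ((lam \x lam)%E P).
  rewrite /product_measure1; apply: eq_integral => x _ /=.
  rewrite (_ : xsection P x = `[0, f x[%classic); last first.
    by apply/seteqP; split=> s; rewrite /xsection/= inE /P/= in_itv/=.
  rewrite lebesgue_measure_itv/= lte_fin; case: ltP => // fx0; last first.
    by congr (_%:E); apply/eqP; rewrite eq_le fx0 f0.
  by rewrite sube0.
transitivity ((lam \x^ lam)%E P).
  by apply: product_measure_unique => //= X Y mX mY; rewrite product_measure2E.
rewrite /product_measure2; apply: eq_integral => s _ /=; congr lebesgue_measure.
exact: hypo_ysection.
Qed.

Definition sym_itv (c : R) : set gR := [set x : R | `|x| <= c].

Let sym_itvE c : sym_itv c = `[- c, c]%classic.
Proof. by apply/seteqP; split=> x; rewrite /sym_itv/= in_itv/= ler_norml. Qed.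

Lemma measurable_sym_itv c : measurable (sym_itv c).
Proof. rewrite sym_itvE; exact: measurable_itv. Qed.

Lemma lebesgue_measure_sym_itv c : 0 <= c -> lam (sym_itv c) = (2 * c)%:E.
Proof.
move=> c0; rewrite sym_itvE; have := @lebesgue_measure_itv R `[- c, c]; rewrite /= lte_fin => ->.
case: ltP => h; rewrite -?EFinN -?EFinD; congr (_%:E); lra.
Qed.

(** Such a set is empty or an interval centred at 0, with or without endpoints, possibly the whole
    line. *)
Definition even_down (I : set R) := forall s t, `|s| <= `|t| -> I t -> I s.

(** A one-dimensional Brunn-Minkowski inequality. Points [a] of [I] and [b] of [J] force the
    interval of radius [(|a| + |b|) / 2] into [C]; suprema over [|a|] and [|b|] then control the
    lengths of [I] and [J]. *)
Lemma midpoint_lebesgue (I J C : set gR) :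
  measurable I -> measurable J -> measurable C -> I 0 -> J 0 ->
  even_down I -> even_down J -> (forall s t, I s -> J t -> C ((s + t) / 2)) ->
  (lam I + lam J <= 2%:E * lam C)%E.
Proof.
move=> mI mJ mC I0 J0 dI dJ IJC.
have [->|] := eqVneq (lam C) +oo%E; first by rewrite gt0_muley// leey.
rewrite -ltey => Coo.
have Cfin : lam C \is a fin_num by rewrite ge0_fin_numE.
have ab (a b : R) : I a -> J b -> `|a| + `|b| <= fine (lam C).
  move=> Ia Jb; rewrite -lee_fin fineK//.
  have sub : sym_itv ((`|a| + `|b|) / 2) `<=` C.
    move=> z; rewrite /sym_itv/= => zab.
    have [ab0|ab0] := eqVneq (`|a| + `|b|) 0.
      have -> : z = (0 + 0) / 2.
        by apply/eqP; rewrite addr0 mul0r -normr_le0 (le_trans zab)// ab0 mul0r.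
      exact: IJC.
    have abp : 0 < `|a| + `|b| by rewrite lt_neqAle eq_sym ab0 addr_ge0.
    (* [z] is the midpoint of [th |a|] and [th |b|] with [|th| <= 1], and these two points stay in
       [I] and [J]. *)
    pose th := 2 * z / (`|a| + `|b|).
    have th1 : `|th| <= 1.
      rewrite /th normrM normfV (gtr0_norm abp) ler_pdivrMr// mul1r normrM ger0_norm//.
      by move: zab; lra.
    have -> : z = (th * `|a| + th * `|b|) / 2 by rewrite /th; field.
    apply: IJC; [apply: dI Ia|apply: dJ Jb];
      by rewrite normrM normr_id ler_piMl.
  have := le_measure lam _ _ sub; rewrite !inE => /(_ _ mC).
  move=> /(_ (measurable_sym_itv _)); apply: le_trans.
  rewrite /= lebesgue_measure_sym_itv ?divr_ge0 ?addr_ge0// lee_fin; lra.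
pose A := sup [set `|a : R| | a in I]; pose B := sup [set `|b : R| | b in J].
have hsA : has_sup [set `|a : R| | a in I].
  split; first by exists `|0 : R|, 0.
  by exists (fine (lam C)) => _ [a Ia <-]; have := ab _ _ Ia J0; rewrite normr0 addr0.
have hsB : has_sup [set `|b : R| | b in J].
  split; first by exists `|0 : R|, 0.
  by exists (fine (lam C)) => _ [a Ia <-]; have := ab _ _ I0 Ia; rewrite normr0 add0r.
have AB : A + B <= fine (lam C).
  rewrite -lerBrDr; apply: ge_sup; first by case: hsA.
  move=> _ [a Ia <-]; rewrite lerBrDr addrC -lerBrDr; apply: ge_sup; first by case: hsB.
  by move=> _ [b Jb <-]; rewrite lerBrDr addrC; exact: ab.
have lamle (X : set gR) : measurable X -> X 0 -> has_sup [set `|a : R| | a in X] ->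
    (lam X <= (2 * sup [set `|a : R| | a in X])%:E)%E.
  move=> mX X0 hX; set c := sup _.
  have c0 : 0 <= c.
    have := sup_upper_bound hX; move=> /(_ `|0 : R|); rewrite normr0; apply.
    by exists (0 : R); rewrite ?normr0.
  have sub : X `<=` sym_itv c.
    move=> x Xx /=; apply: (sup_upper_bound hX).
    by exists x.
  have := le_measure lam _ _ sub; rewrite !inE => /(_ mX (measurable_sym_itv _)) /le_trans; apply.
  by rewrite /= lebesgue_measure_sym_itv.
rewrite -(fineK Cfin) -EFinM.
apply: (le_trans (leeD (lamle _ mI I0 hsA) (lamle _ mJ J0 hsB))).
by rewrite -EFinD lee_fin -/A -/B; move: AB; lra.
Qed.

(* At every height s in [0, 1[ both level sets contain 0, so the midpoint
   inequality holds between their lengths; integrate over s. *)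
Lemma prekopa1_norm (al be ga : gR -> R) :
  measurable_fun setT al -> measurable_fun setT be -> measurable_fun setT ga ->
  (forall x, 0 <= al x) -> (forall x, 0 <= be x) -> (forall x, 0 <= ga x) ->
  (forall s t, `|s| <= `|t| -> al t <= al s) ->
  (forall s t, `|s| <= `|t| -> be t <= be s) ->
  (forall s t, al s * be t <= ga ((s + t) / 2) ^+ 2) ->
  al 0 = 1 -> be 0 = 1 ->
  (\int[lam]_x (al x)%:E + \int[lam]_x (be x)%:E <= 2%:E * \int[lam]_x (ga x)%:E)%E.
Proof.
move=> mal mbe mga al0 be0 ga0 dal dbe H al1 be1.
have mlev (f : gR -> R) s : measurable_fun setT f -> measurable [set x : gR | 0 <= s < f x].
  move=> mf; have [s0|s0] := leP 0 s; last first.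
    by rewrite (_ : [set _ | _] = set0)//; apply/seteqP; split.
  rewrite -[X in measurable X]setTI.
  have := measurable_fun_ltr (@measurable_cst _ _ _ _ setT s) mf.
  by move=> /(_ measurableT [set true]); apply.
have mlevf (f : gR -> R) : measurable_fun setT f -> (forall x, 0 <= f x) ->
    measurable_fun setT (fun s : gR => lam [set x : gR | (0 <= s < f x)%R]).
  move=> mf f0; have := measurable_fun_ysection lam (measurable_hypo mf).
  by congr (measurable_fun _ _); apply/funext => s' /=; rewrite hypo_ysection.
have lev (s : gR) : (lam [set x : gR | (0 <= s < al x)%R] + lam [set x : gR | (0 <= s < be x)%R] <=
    2%:E * lam [set x : gR | (0 <= s < ga x)%R])%E.
  have [s0|s0] : s < 0 \/ 0 <= s by case: ltP => ?; [left|right].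
    have lev0 (f : gR -> R) : [set x : gR | 0 <= s < f x] = set0.
      by apply/seteqP; split=> // x /= /andP[]; rewrite leNgt s0.
    by rewrite !lev0 measure0 adde0 mule0.
  (* Both [al] and [be] are largest at 0, with value 1, so their level sets at heights [s >= 1] are
     empty. *)
  have [s1|s1] : 1 <= s \/ s < 1 by case: ltP => ?; [right|left].
    rewrite [X in lam X](_ : _ = set0); last first.
      apply/seteqP; split=> // x /= /andP[_ sx].
      have := dal 0 x; rewrite normr0 => /(_ (normr_ge0 _)).
      by rewrite al1 leNgt (le_lt_trans s1 sx).
    rewrite [X in (_ + lam X)%E](_ : _ = set0); last first.
      apply/seteqP; split=> // x /= /andP[_ sx].
      have := dbe 0 x; rewrite normr0 => /(_ (normr_ge0 _)).
      by rewrite be1 leNgt (le_lt_trans s1 sx).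
    by rewrite measure0 adde0 mule_ge0.
  apply: midpoint_lebesgue; do ?exact: mlev.
  - by rewrite /= s0 al1.
  - by rewrite /= s0 be1.
  - by move=> x y xy /= /andP[-> sy]; exact: lt_le_trans sy (dal _ _ xy).
  - by move=> x y xy /= /andP[-> sy]; exact: lt_le_trans sy (dbe _ _ xy).
  - move=> x y /andP[_ sx] /andP[_ sy]; apply/andP; split=> //.
    have g0 := ga0 ((x + y) / 2); rewrite ltNge; apply/negP => gs.
    have : s * s < al x * be y by apply: ltr_pM.
    by apply/negP; rewrite -leNgt (le_trans (H x y))// expr2 ler_pM.
rewrite !layer_cake//.
rewrite -ge0_integralD//; do ?exact: mlevf.
rewrite -ge0_integralZl//; do ?exact: mlevf.
apply: ge0_le_integral => //.
- by move=> *; rewrite adde_ge0.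
- by apply: emeasurable_funD; exact: mlevf.
- by apply: measurable_funeM; exact: mlevf.
Qed.


(* Dividing by the maxima al 0 and be 0 turns the arithmetic mean of
   prekopa1_norm into a geometric one. *)
Lemma prekopa1 (al be ga : gR -> R) :
  measurable_fun setT al -> measurable_fun setT be -> measurable_fun setT ga ->
  (forall x, 0 <= al x) -> (forall x, 0 <= be x) -> (forall x, 0 <= ga x) ->
  (forall s t, `|s| <= `|t| -> al t <= al s) ->
  (forall s t, `|s| <= `|t| -> be t <= be s) ->
  (forall s t, al s * be t <= ga ((s + t) / 2) ^+ 2) ->
  (\int[lam]_x (al x)%:E * \int[lam]_x (be x)%:E <=
   \int[lam]_x (ga x)%:E * \int[lam]_x (ga x)%:E)%E.
Proof.
move=> mal mbe mga al0 be0 ga0 dal dbe H.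
have int0 (f : gR -> R) : (forall x, 0 <= f x) -> (forall s t, `|s| <= `|t| -> f t <= f s) ->
    f 0 = 0 -> (\int[lam]_x (f x)%:E = 0)%E.
  move=> f0 df f00; apply: integral0_eq => x _; congr (_%:E); apply/eqP.
  by rewrite eq_le f0 andbT -f00; apply: df; rewrite normr0.
have Z0 : (0 <= \int[lam]_x (ga x)%:E)%E by apply: integral_ge0 => x _; rewrite lee_fin.
have [a0|a0] := eqVneq (al 0) 0; first by rewrite (int0 al)// mul0e mule_ge0.
have [b0|b0] := eqVneq (be 0) 0; first by rewrite (int0 be)// mule0 mule_ge0.
have ap : 0 < al 0 by rewrite lt_neqAle eq_sym a0 al0.
have bp : 0 < be 0 by rewrite lt_neqAle eq_sym b0 be0.
pose c := Num.sqrt (al 0 * be 0).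
have c2 : c ^+ 2 = al 0 * be 0 by rewrite sqr_sqrtr// mulr_ge0.
have cp : 0 < c by rewrite sqrtr_gt0 mulr_gt0.
have mZ (f : gR -> R) k : measurable_fun setT f -> measurable_fun setT (fun x : gR => k * f x).
  by move=> mf; apply: measurable_funM.
have intZ (f : gR -> R) k : measurable_fun setT f -> (forall x, 0 <= f x) -> 0 <= k ->
    (\int[lam]_x (k * f x)%:E = k%:E * \int[lam]_x (f x)%:E)%E.
  move=> mf f0 k0; under eq_integral do rewrite EFinM.
  apply: ge0_integralZl => //; do ?[exact/measurable_EFinP|by move=> x _; rewrite lee_fin].
have key : ((al 0)^-1%:E * \int[lam]_x (al x)%:E + (be 0)^-1%:E * \int[lam]_x (be x)%:E
    <= 2%:E * (c^-1%:E * \int[lam]_x (ga x)%:E))%E.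
  rewrite -(intZ al) -?(intZ be) -?(intZ ga c^-1) ?invr_ge0//; do ?exact: ltW.
  apply: (@prekopa1_norm (fun x => (al 0)^-1 * al x) (fun x => (be 0)^-1 * be x)
    (fun x => c^-1 * ga x)); do ?exact: mZ.
  - by move=> x; rewrite mulr_ge0// invr_ge0 ltW.
  - by move=> x; rewrite mulr_ge0// invr_ge0 ltW.
  - by move=> x; rewrite mulr_ge0// invr_ge0 ltW.
  - by move=> s t st; rewrite ler_pM2l ?invr_gt0//; exact: dal.
  - by move=> s t st; rewrite ler_pM2l ?invr_gt0//; exact: dbe.
  - move=> s t; rewrite exprMn exprVn c2 invfM mulrACA.
    by rewrite ler_pM2l// mulr_gt0 ?invr_gt0.
  - by rewrite mulVf.
  - by rewrite mulVf.
have X0 : (0 <= \int[lam]_x (al x)%:E)%E by apply: integral_ge0 => x _; rewrite lee_fin.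
have Y0 : (0 <= \int[lam]_x (be x)%:E)%E by apply: integral_ge0 => x _; rewrite lee_fin.
move: X0 Y0 Z0 key.
move: (\int[lam]_x (al x)%:E)%E (\int[lam]_x (be x)%:E)%E (\int[lam]_x (ga x)%:E)%E.
move=> X Y [z| |] X0 Y0 Z0//; last by rewrite mulyy leey.
have ap' : 0 < (al 0)^-1 by rewrite invr_gt0.
have bp' : 0 < (be 0)^-1 by rewrite invr_gt0.
(* As the integral [z] of [ga] is finite, [key] rules out an infinite integral of [al] or [be]. *)
move: X Y X0 Y0 => [x| |] [y| |]// x0 y0 key;
  try by exfalso; move: key; rewrite !gt0_muley ?lte_fin// ?addye ?addey.
move: key; rewrite -!EFinM -EFinD !lee_fin in x0 y0 Z0 *.
set u := _^-1 * x; set v := _^-1 * y; set w := c^-1 * z => uvw.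
have u0 : 0 <= u by rewrite mulr_ge0// ltW.
have v0 : 0 <= v by rewrite mulr_ge0// ltW.
have uv : u * v <= w ^+ 2.
  have : (u + v) ^+ 2 <= (2 * w) ^+ 2.
    by rewrite ler_pXn2r// nnegrE; [exact: addr_ge0|exact: le_trans (addr_ge0 u0 v0) uvw].
  have := sqr_ge0 (u - v); lra.
have -> : x * y = c ^+ 2 * (u * v) by rewrite c2 /u /v; field; rewrite a0 b0.
have -> : z * z = c ^+ 2 * w ^+ 2 by rewrite /w; field; rewrite gt_eqF.
by rewrite ler_pM2l// exprn_gt0.
Qed.

End prekopa.

(** * Solid sets, their slices and their volumes *)

Section solid.
Variable R : realType.
Local Notation lam := (@lebesgue_measure R).
Local Notation gR := (measurableTypeR R).

(** Slices inherit this property and shrink as [|t|] grows, so that slice volumes are even and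
    nonincreasing in [|t|], as [prekopa1] requires. *)
Definition solid n (A : set 'rV[R]_n) :=
  forall x y : 'rV[R]_n, A x -> (forall i, `|y ord0 i| <= `|x ord0 i|) -> A y.

Lemma solid_slice n (A : set 'rV[R]_n.+1) t : solid A -> solid (rV_slice A t).
Proof.
move=> sA x y Ax yx; apply: sA Ax _ => i.
by case: (unliftP ord0 i) => [j|] ->; rewrite ?rV_consS ?rV_cons0.
Qed.

Lemma solid_slice_sub n (A : set 'rV[R]_n.+1) s t : solid A -> `|s| <= `|t| ->
  rV_slice A t `<=` rV_slice A s.
Proof.
move=> sA st v Av; apply: sA Av _ => i.
by case: (unliftP ord0 i) => [j|] ->; rewrite ?rV_consS ?rV_cons0.
Qed.

Definition rV_cube n (M : R) : set 'rV[R]_n := [set x | forall i, `|x ord0 i| <= M].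

Lemma rV_cubeE n M : rV_cube M = @rV_box R n (fun=> `[(- M)%R, M]%classic).
Proof.
by apply/seteqP; split=> x h i; have := h i; rewrite /= in_itv/= ler_norml.
Qed.

Lemma measurable_rV_cube n M : measurable (rV_cube M : set 'rV[R]_n).
Proof. by rewrite rV_cubeE; apply: measurable_rV_box. Qed.

Lemma cube_slice n (A : set 'rV[R]_n.+1) t M : A `<=` rV_cube M ->
  rV_slice A t `<=` rV_cube M.
Proof. by move=> AM v Av i; have := AM _ Av (lift ord0 i); rewrite rV_consS. Qed.

Lemma cube_fin_num n (A : set 'rV[R]_n) M : measurable A -> A `<=` rV_cube M ->
  lebesgue_rV R n A \is a fin_num.
Proof.
move=> mA AM; rewrite ge0_fin_numE//.
apply: (@le_lt_trans _ _ (lebesgue_rV R n (rV_cube M))).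
  by apply: le_measure AM; rewrite inE; [exact: mA|exact: measurable_rV_cube].
rewrite [X in lebesgue_rV R n X](rV_cubeE n M); exact: lebesgue_rV_cube_lty.
Qed.

(** Induction on the dimension: the induction hypothesis for the slices at [s], [t] and
    [(s + t) / 2] is the product inequality that [prekopa1] needs for the slice volumes. The common
    cube keeps all volumes finite. In dimension 0 the measure is a Dirac mass and the claim is about
    membership of 0. *)
Lemma solid_prekopa n (A B C : set 'rV[R]_n) M :
  measurable A -> measurable B -> measurable C -> solid A -> solid B ->
  A `<=` rV_cube M -> B `<=` rV_cube M -> C `<=` rV_cube M ->
  (forall x y, A x -> B y -> C (2^-1 *: (x + y))) ->
  (lebesgue_rV R n A * lebesgue_rV R n B <= lebesgue_rV R n C * lebesgue_rV R n C)%E.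
Proof.
elim: n A B C => [|n IH] A B C mA mB mC sA sB AM BM CM H.
  rewrite /= !diracE.
  have [A0|] := boolP (0 \in A); last by rewrite mul0e mule_ge0.
  have [B0|] := boolP (0 \in B); last by rewrite mule0 mule_ge0.
  have := H _ _ (set_mem A0) (set_mem B0); rewrite addr0 scaler0 => C0.
  by rewrite mem_set.
have fin X t : measurable X -> X `<=` rV_cube M -> lebesgue_rV R n (rV_slice X t) \is a fin_num.
  by move=> mX XM; apply: cube_fin_num (cube_slice XM); exact: measurable_rV_slice.
pose sl (X : set 'rV[R]_n.+1) (t : gR) : R := fine (lebesgue_rV R n (rV_slice X t)).
have slE X : measurable X -> X `<=` rV_cube M ->
    lebesgue_rV R n.+1 X = (\int[lam]_t (sl X t)%:E)%E.
  move=> mX XM; rewrite lebesgue_rV_slice; apply: eq_integral => t _.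
  by rewrite fineK// fin.
have msl X : measurable X -> measurable_fun setT (sl X).
  move=> mX; apply: measurableT_comp (measurable_fun_slice mX); exact: fine_measurable.
have sl0 X t : 0 <= sl X t by rewrite fine_ge0.
have dsl X : measurable X -> X `<=` rV_cube M -> solid X ->
    forall s t, `|s| <= `|t| -> sl X t <= sl X s.
  move=> mX XM sX s t st; rewrite fine_le ?fin// le_measure ?inE//.
  - exact: measurable_rV_slice.
  - exact: measurable_rV_slice.
  - exact: solid_slice_sub.
rewrite !slE//; apply: prekopa1; do ?[exact: msl|exact: sl0|exact: dsl].
move=> s t; rewrite -lee_fin EFinM expr2 EFinM !fineK ?fin//.
apply: IH; do ?[exact: measurable_rV_slice|exact: solid_slice|exact: cube_slice].
move=> x y /= /H{}H /H; congr C; apply/rowP => i.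
have midE m (u v : 'rV[R]_m) k : (2^-1 *: (u + v)) ord0 k = 2^-1 * (u ord0 k + v ord0 k).
  by rewrite !mxE.
case: (unliftP ord0 i) => [j|] ->; rewrite midE ?rV_consS ?rV_cons0 ?midE//.
by rewrite mulrC.
Qed.

End solid.

(** * Comparison of first and second moments *)

Section moments.
Variable R : realType.
Local Notation lam := (@lebesgue_measure R).
Local Notation gR := (measurableTypeR R).

Lemma ge0_integral_dilate (c : R) (f : gR -> \bar R) : 0 < c ->
  measurable_fun setT f -> (forall x, 0 <= f x)%E ->
  (\int[lam]_x f x = c%:E * \int[lam]_x f (c * x)%R)%E.
Proof.
move=> c0 mf f0.
have mc : measurable_fun setT ((fun x : R => c * x)%R : gR -> gR).
  exact: measurable_funM.
pose m1 := measure_function_pushforward__canonical__measure_function_Measure lam mc.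
transitivity (\int[mscale (NngNum (ltW c0)) m1]_x f x)%E.
  apply: eq_measure_integral => A mA _; exact: lebesgue_measure_dilate.
rewrite ge0_integral_mscale//; congr (_ * _)%E.
by rewrite (@ge0_integral_pushforward _ _ _ _ _ _ mc lam setT f).
Qed.

Lemma integral_indic_sym (K c : R) : 0 <= K -> 0 <= c ->
  (\int[lam]_x (K * \1_(sym_itv c) x)%:E = (K * (2 * c))%:E)%E.
Proof.
move=> K0 c0; under eq_integral do rewrite EFinM.
rewrite ge0_integralZl//; last first.
  by apply/measurable_EFinP; apply: measurable_indic; exact: measurable_sym_itv.
rewrite integral_indic//; last exact: measurable_sym_itv.
by rewrite setIT [X in (_ * X)%E](lebesgue_measure_sym_itv c0).
Qed.

Lemma measurable_indic_sym (K c : R) :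
  measurable_fun setT (fun t : gR => K * \1_(sym_itv c) t).
Proof.
apply: measurable_funM => //; apply: measurable_indic; exact: measurable_sym_itv.
Qed.

Lemma integral_le_sym (f : gR -> R) (K c : R) : 0 <= K -> 0 <= c ->
  measurable_fun setT f -> (forall x, 0 <= f x) ->
  (forall x, f x <= K * \1_(sym_itv c) x) ->
  (\int[lam]_x (f x)%:E <= (K * (2 * c))%:E)%E.
Proof.
move=> K0 c0 mf f0 fK; rewrite -integral_indic_sym//.
apply: ge0_le_integral => //.
- by move=> x _; rewrite lee_fin.
- exact/measurable_EFinP.
- apply/measurable_EFinP; exact: measurable_indic_sym.
- by move=> x _; rewrite lee_fin.
Qed.

(* Substitute x -> 2x and absorb the term th * f, which is why finiteness of the
   integral is assumed. *)
Lemma integral_absorb (f : gR -> R) (K c th B : R) : 0 <= K -> 0 <= c ->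
  0 <= th -> measurable_fun setT f -> (forall x, 0 <= f x) ->
  (forall x, f (2 * x) <= K * \1_(sym_itv c) x + th * f x) ->
  (\int[lam]_x (f x)%:E <= B%:E)%E ->
  ((1 - 2 * th)%:E * \int[lam]_x (f x)%:E <= (4 * K * c)%:E)%E.
Proof.
move=> K0 c0 th0 mf f0 fK fB.
have ge0I : (0 <= \int[lam]_t (f t)%:E)%E by apply: integral_ge0 => t _; rewrite lee_fin.
have Ifin : (\int[lam]_t (f t)%:E)%E \is a fin_num.
  by rewrite ge0_fin_numE// (le_lt_trans fB)// ltry.
pose I := (\int[lam]_t (f t)%:E)%E.
have : (I <= 2%:E * ((K * (2 * c))%:E + th%:E * I))%E.
  rewrite /I [leLHS](ge0_integral_dilate (c := 2))//;
    do ?[exact/measurable_EFinP|by move=> *; rewrite lee_fin].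
  rewrite lee_pmul2l//.
  rewrite -integral_indic_sym// -ge0_integralZl//;
    do ?[exact/measurable_EFinP|by move=> *; rewrite lee_fin].
  rewrite -ge0_integralD//; do ?[by apply: measurable_funeM; exact/measurable_EFinP
    |by move=> *; rewrite ?mule_ge0 ?lee_fin ?mulr_ge0
    |apply/measurable_EFinP; exact: measurable_indic_sym].
  apply: ge0_le_integral => //.
  - by move=> x _; rewrite lee_fin.
  - have m2 : measurable_fun setT (fun t : gR => 2 * t : gR) by exact: measurable_funM.
    apply/measurable_EFinP; exact: measurableT_comp m2.
  - apply: emeasurable_funD.
      apply/measurable_EFinP; exact: measurable_indic_sym.
    by apply: measurable_funeM; exact/measurable_EFinP.
  - by move=> x _; rewrite -EFinM -EFinD lee_fin.
rewrite /I -(fineK Ifin) -!EFinM !lee_fin; lra.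
Qed.

Section one_dim.
Variables (g : gR -> R) (M : R).
Hypothesis mg : measurable_fun setT g.
Hypothesis g0 : forall x, 0 <= g x.
Hypothesis dg : forall s t, `|s| <= `|t| -> g t <= g s.
Hypothesis g2 : forall t, g (2 * t) * g 0 <= g t ^+ 2.
Hypothesis gM : forall t, M < `|t| -> g t = 0.

Let E : set R := [set t | 0 <= t /\ g 0 / 16 <= g t].

(* With a the last point where g >= g 0 / 16, both int g and int t^2 g are
   concentrated on [-a, a]: int g <= 5 g0 a, int t^2 g <= 32 g0 a^3 and
   int |t| g >= a^2 g0 / 128, so any constant above 128 sqrt 160 = 1619.1... does. *)
Lemma moment_1d :
  (\int[lam]_t (t ^+ 2 * g t)%:E * \int[lam]_t (g t)%:E <=
   (1620 ^+ 2)%:E * (\int[lam]_t (`|t| * g t)%:E * \int[lam]_t (`|t| * g t)%:E))%E.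
Proof.
have mabs : measurable_fun setT (fun t : gR => `|t : R|) by exact: measurableT_comp.
have msq : measurable_fun setT (fun t : gR => (t : R) ^+ 2) by exact: measurable_funX.
have m2g : measurable_fun setT (fun t : gR => t ^+ 2 * g t) by exact: measurable_funM.
have m1g : measurable_fun setT (fun t : gR => `|t| * g t) by exact: measurable_funM.
have [g00|g00] := eqVneq (g 0) 0.
  have -> : (\int[lam]_t (g t)%:E = 0)%E.
    apply: integral0_eq => t _; congr (_%:E); apply/eqP.
    by rewrite eq_le g0 andbT -g00; apply: dg; rewrite normr0.
  rewrite mule0; apply: mule_ge0; first by rewrite lee_fin sqr_ge0.
  by apply: mule_ge0; apply: integral_ge0 => x _; rewrite lee_fin mulr_ge0.
have gp : 0 < g 0 by rewrite lt_neqAle eq_sym g00 g0.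
have E0 : E 0 by split=> //; rewrite ler_pdivrMr// ler_peMr//; lra.
have EM t : E t -> t <= M.
  move=> [t0 gt]; rewrite leNgt; apply/negP => Mt.
  by move: gt; rewrite (gM (t := t)) ?ger0_norm//; apply/negP; rewrite -ltNge divr_gt0.
have hE : has_sup E by split; [exists 0|exists M].
pose a := sup E.
have a0 : 0 <= a by exact: (sup_upper_bound hE).
have gbig t : `|t| < a -> g 0 / 16 <= g t.
  move=> ta; have [s [s0 gs] ts] := sup_gt hE.1 ta.
  by apply: le_trans gs _; apply: dg; rewrite (ger0_norm s0) ltW.
have gsmall t : a < `|t| -> g t < g 0 / 16.
  move=> ta; rewrite ltNge; apply/negP => gt.
  suff : `|t| <= a by rewrite leNgt ta.
  apply: (sup_upper_bound hE); split=> //; apply: le_trans gt _; apply: dg.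
  by rewrite normr_id.
(* For [|t| > a], [g (2 t) g 0 <= g t ^ 2] and [g t < g 0 / 16] give [g (2 t) <= g t / 16]: the tail
   decays geometrically. *)
have key t : g (2 * t) <= g 0 * \1_(sym_itv a) t + 16^-1 * g t.
  rewrite indicE; have [ta|ta] := leP `|t| a.
    rewrite mem_set//= mulr1 -[leLHS]addr0 lerD//; last by rewrite mulr_ge0.
    by apply: dg; rewrite normr0.
  rewrite memNset/=; last by rewrite /sym_itv/=; apply/negP; rewrite -ltNge.
  rewrite mulr0 add0r -(ler_pM2r gp); apply: le_trans (g2 t) _.
  rewrite expr2 mulrAC [leRHS]mulrC ler_wpM2l// mulrC ltW// gsmall//.
have M0 : 0 <= M by exact: EM.
(* The bounded support yields crude bounds, which serve only as the finiteness assumption of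
   [integral_absorb]. *)
have gle t : g t <= g 0 * \1_(sym_itv M) t.
  rewrite indicE; have [tM|tM] := leP `|t| M.
    by rewrite mem_set// mulr1; apply: dg; rewrite normr0.
  by rewrite gM// mulr_ge0.
have I0fin : (\int[lam]_t (g t)%:E <= (g 0 * (2 * M))%:E)%E by exact: integral_le_sym.
have I2fin : (\int[lam]_t (t ^+ 2 * g t)%:E <= (M ^+ 2 * g 0 * (2 * M))%:E)%E.
  apply: integral_le_sym => //; first by rewrite mulr_ge0 ?sqr_ge0.
    by move=> t; rewrite mulr_ge0 ?sqr_ge0.
  move=> t; rewrite indicE; have [tM|tM] := leP `|t| M.
    rewrite mem_set// mulr1 ler_pM ?sqr_ge0//.
      by rewrite -real_normK ?num_real// ler_pXn2r ?nnegrE.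
    by apply: dg; rewrite normr0.
  by rewrite gM// mulr0 mulr_ge0// mulr_ge0 ?sqr_ge0.
(* Here [1 - 2 / 16 = 7 / 8] and [4 * 8 / 7 < 5]. *)
have I0 : (\int[lam]_t (g t)%:E <= (5 * g 0 * a)%:E)%E.
  have Ifin : (\int[lam]_t (g t)%:E)%E \is a fin_num.
    by rewrite ge0_fin_numE ?(le_lt_trans I0fin) ?ltry// integral_ge0// => t _; rewrite lee_fin.
  have := integral_absorb (ltW gp) a0 _ mg g0 key I0fin.
  have ga : 0 <= g 0 * a by exact: mulr_ge0.
  move=> /(_ (ltac:(lra))); rewrite -(fineK Ifin) -!EFinM !lee_fin; lra.
have I2 : (\int[lam]_t (t ^+ 2 * g t)%:E <= (32 * g 0 * a ^+ 3)%:E)%E.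
  have Ifin : (\int[lam]_t (t ^+ 2 * g t)%:E)%E \is a fin_num.
    rewrite ge0_fin_numE ?(le_lt_trans I2fin) ?ltry// integral_ge0// => t _.
    by rewrite lee_fin mulr_ge0// sqr_ge0.
  (* The weight [t ^ 2] costs a factor 4 under [t -> 2 t], so the decay rate 1/16 becomes 1/4, still
     small enough to be absorbed: [1 - 2 / 4 = 1 / 2]. *)
  have -> : 32 * g 0 * a ^+ 3 = 2 * (4 * (4 * a ^+ 2 * g 0) * a) by ring.
  suff : ((1 - 2 * 4^-1)%:E * \int[lam]_t (t ^+ 2 * g t)%:E <= (4 * (4 * a ^+ 2 * g 0) * a)%:E)%E.
    rewrite -(fineK Ifin) -!EFinM !lee_fin; set b := 4 * _ * a; lra.
  apply: (@integral_absorb _ _ _ _ (M ^+ 2 * g 0 * (2 * M))) => //.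
  - by rewrite !mulr_ge0// sqr_ge0.
  - by move=> x; rewrite mulr_ge0 ?sqr_ge0.
  - move=> t; apply: (@le_trans _ _ ((2 * t) ^+ 2 * (g 0 * \1_(sym_itv a) t + 16^-1 * g t))).
      by rewrite ler_wpM2l ?sqr_ge0.
    rewrite mulrDr exprMn.
    have -> : 2 ^+ 2 * t ^+ 2 * (16^-1 * g t) = 4^-1 * (t ^+ 2 * g t) by field.
    rewrite lerD2r.
    rewrite indicE; have [ta|ta] := leP `|t| a.
      rewrite mem_set// !mulr1 ler_wpM2r// (_ : 4 = 2 ^+ 2); last by ring.
      by rewrite ler_wpM2l ?sqr_ge0// -(real_normK (num_real t)) ler_pXn2r ?nnegrE.
    rewrite memNset/=; last by rewrite /sym_itv/=; apply/negP; rewrite -ltNge.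
    by rewrite !mulr0.
have I1 : ((a ^+ 2 * g 0 / 128)%:E <= \int[lam]_t (`|t| * g t)%:E)%E.
  have ge0I : (0 <= \int[lam]_t (`|t| * g t)%:E)%E.
    by apply: integral_ge0 => t _; rewrite lee_fin mulr_ge0.
  have [->|an0] := eqVneq a 0; first by rewrite expr0n/= !mul0r.
  have ap : 0 < a by rewrite lt_neqAle eq_sym an0.
  (* On the shell [a / 4 < |t| <= a / 2], of total length [a / 2], the integrand is at least [K].
     The shell is a difference of two symmetric intervals, and the inner indicator is moved to the
     other side. *)
  pose K := a / 4 * (g 0 / 16).
  have K0 : 0 <= K by rewrite mulr_ge0// divr_ge0.
  have : ((K * (2 * (a / 2)))%:E <=
      \int[lam]_t (`|t| * g t + K * \1_(sym_itv (a / 4)) t)%:E)%E.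
    rewrite -integral_indic_sym ?divr_ge0//.
    apply: ge0_le_integral => //.
    - by move=> x _; rewrite lee_fin mulr_ge0.
    - apply/measurable_EFinP; exact: measurable_indic_sym.
    - apply/measurable_EFinP; apply: measurable_funD => //; exact: measurable_indic_sym.
    move=> t _; rewrite lee_fin.
    have tg0 : 0 <= `|t| * g t by rewrite mulr_ge0.
    rewrite !indicE; have [t2|t2] := leP `|t| (a / 2); last first.
      rewrite memNset/=; last by rewrite /sym_itv/=; apply/negP; rewrite -ltNge.
      by rewrite mulr0 addr_ge0// mulr_ge0.
    rewrite mem_set// mulr1; have [t4|t4] := leP `|t| (a / 4).
      by rewrite mem_set// mulr1 lerDr.
    rewrite memNset/=; last by rewrite /sym_itv/=; apply/negP; rewrite -ltNge.
    rewrite mulr0 addr0 ler_pM ?divr_ge0//; first exact: ltW.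
    by apply: gbig; apply: le_lt_trans t2 _; lra.
  under eq_integral do rewrite EFinD.
  rewrite ge0_integralD//; do ?[apply/measurable_EFinP; exact: measurable_indic_sym
    |exact/measurable_EFinP|by move=> *; rewrite lee_fin mulr_ge0].
  rewrite integral_indic_sym ?divr_ge0//.
  move: ge0I; case: (\int[lam]_t (`|t| * g t)%:E)%E => [x| |]// x0; last by move=> _; rewrite leey.
  rewrite -EFinD !lee_fin => H.
  have -> : a ^+ 2 * g 0 / 128 = K * (a / 2) by rewrite /K; field.
  lra.
have ga2 : (0 <= (a ^+ 2 * g 0 / 128)%:E)%E by rewrite lee_fin divr_ge0// mulr_ge0// sqr_ge0.
have e0 (h : gR -> R) : (forall t, 0 <= h t) -> (0 <= \int[lam]_t (h t)%:E)%E.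
  by move=> h0; apply: integral_ge0 => t _; rewrite lee_fin.
have I1' := lee_pmul ga2 ga2 I1 I1.
apply: (@le_trans _ _ ((1620 ^+ 2)%:E *
    ((a ^+ 2 * g 0 / 128)%:E * (a ^+ 2 * g 0 / 128)%:E)))%E; last first.
  apply: lee_pmul; [by rewrite lee_fin sqr_ge0|exact: mule_ge0|exact: lexx|exact: I1'].
apply: (@le_trans _ _ ((32 * g 0 * a ^+ 3)%:E * (5 * g 0 * a)%:E))%E.
  apply: lee_pmul => //; last exact: e0.
  by apply: e0 => t; rewrite mulr_ge0// sqr_ge0.
rewrite -!EFinM lee_fin.
have z0 : 0 <= g 0 ^+ 2 * a ^+ 4 by rewrite mulr_ge0 ?sqr_ge0// exprn_ge0.
have -> : 32 * g 0 * a ^+ 3 * (5 * g 0 * a) = 160 * (g 0 ^+ 2 * a ^+ 4) by ring.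
have -> : 1620 ^+ 2 * (a ^+ 2 * g 0 / 128 * (a ^+ 2 * g 0 / 128)) =
  (1620 / 128) ^+ 2 * (g 0 ^+ 2 * a ^+ 4) by field.
by rewrite ler_wpM2r//; lra.
Qed.

End one_dim.
End moments.

(** * Moments of the coordinates over a solid set *)

Section rV_moments.
Variable R : realType.
Local Notation lam := (@lebesgue_measure R).
Local Notation gR := (measurableTypeR R).

Lemma integral_coord0 n (Q : set 'rV[R]_n.+1) M (phi : gR -> R) :
  measurable Q -> Q `<=` rV_cube M -> measurable_fun setT phi ->
  (forall t, 0 <= phi t) ->
  (\int[lebesgue_rV R n.+1]_(x in Q) (phi (x ord0 ord0))%:E =
   \int[lam]_t (phi t * fine (lebesgue_rV R n (rV_slice Q t)))%:E)%E.
Proof.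
move=> mQ QM mphi phi0.
pose f (x : 'rV[R]_n.+1) : \bar R := (phi (x ord0 ord0) * \1_Q x)%:E.
have mf : measurable_fun setT f.
  apply/measurable_EFinP; apply: measurable_funM; last exact: measurable_indic.
  by apply: measurableT_comp mphi _; exact: measurable_rV_coord_fun.
transitivity (\int[lebesgue_rV R n.+1]_x f x)%E.
  rewrite integral_mkcond; apply: eq_integral => x _.
  rewrite patchE /f indicE; case: ifP => _; first by rewrite mulr1.
  by rewrite mulr0.
rewrite ge0_integral_rV_cons//; last first.
  by move=> x; rewrite lee_fin mulr_ge0.
apply: eq_integral => t _.
have mS : measurable (rV_slice Q t) by exact: measurable_rV_slice.
transitivity (\int[lebesgue_rV R n]_v ((phi t)%:E * (\1_(rV_slice Q t) v)%:E))%E.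
  apply: eq_integral => v _; rewrite /f -EFinM rV_cons0; congr (_ * _)%:E.
rewrite ge0_integralZl//; do ?[by apply/measurable_EFinP; exact: measurable_indic
  |by rewrite lee_fin].
rewrite integral_indic// setIT EFinM fineK//.
by apply: (cube_fin_num mS); exact: cube_slice QM.
Qed.

Definition midconvex n (Q : set 'rV[R]_n) :=
  forall x y, Q x -> Q y -> Q (2^-1 *: (x + y)).

(** Apply [moment_1d] to the slice volume [g]. Its hypothesis [g (2 t) g 0 <= g t ^ 2] is
    [solid_prekopa] for the slices at [2 t], [0] and [t]. *)
Lemma moment_coord0 n (Q : set 'rV[R]_n.+1) M :
  measurable Q -> Q `<=` rV_cube M -> solid Q -> midconvex Q ->
  (\int[lebesgue_rV R n.+1]_(x in Q) (x ord0 ord0 ^+ 2)%:E * lebesgue_rV R n.+1 Q <=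
   (1620 ^+ 2)%:E * (\int[lebesgue_rV R n.+1]_(x in Q) `|x ord0 ord0|%:E *
     \int[lebesgue_rV R n.+1]_(x in Q) `|x ord0 ord0|%:E))%E.
Proof.
move=> mQ QM sQ cQ.
pose g (t : gR) : R := fine (lebesgue_rV R n (rV_slice Q t)).
have finS t : lebesgue_rV R n (rV_slice Q t) \is a fin_num.
  by apply: cube_fin_num (cube_slice QM); exact: measurable_rV_slice.
have -> : (lebesgue_rV R n.+1 Q = \int[lam]_t (g t)%:E)%E.
  by rewrite lebesgue_rV_slice; apply: eq_integral => t _; rewrite fineK.
rewrite (@integral_coord0 _ _ M (fun t => t ^+ 2))//; 
  do ?[exact: measurable_funX|by move=> *; exact: sqr_ge0].
rewrite (@integral_coord0 _ _ M (fun t => `|t|))//; do ?exact: measurableT_comp.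
apply: (@moment_1d R g M).
- apply: measurableT_comp (measurable_fun_slice mQ); exact: fine_measurable.
- by move=> x; rewrite fine_ge0.
- move=> s t st; rewrite fine_le// le_measure// ?inE; do ?exact: measurable_rV_slice.
  exact: solid_slice_sub.
- move=> t; rewrite -lee_fin EFinM expr2 EFinM !fineK//.
  apply: (@solid_prekopa _ _ _ _ _ M);
    do ?[exact: measurable_rV_slice|exact: solid_slice|exact: cube_slice].
  move=> x y /= Qx Qy; have := cQ _ _ Qx Qy; congr Q; apply/rowP => i.
  have midE m (u v : 'rV[R]_m) k : (2^-1 *: (u + v)) ord0 k = 2^-1 * (u ord0 k + v ord0 k).
    by rewrite !mxE.
  case: (unliftP ord0 i) => [j|] ->; rewrite midE ?rV_consS ?rV_cons0 ?midE//.
  by field.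
- move=> t Mt; rewrite /g (_ : rV_slice Q t = set0) ?measure0//.
  apply/seteqP; split=> // v /QM /(_ ord0); rewrite rV_cons0.
  by rewrite leNgt Mt.
Qed.

(** The transposition of coordinates 0 and [i] preserves the measure and all hypotheses, which
    reduces the claim to [moment_coord0]. *)
Lemma moment_coord n (Q : set 'rV[R]_n) M (i : 'I_n) :
  measurable Q -> Q `<=` rV_cube M -> solid Q -> midconvex Q ->
  (\int[lebesgue_rV R n]_(x in Q) (x ord0 i ^+ 2)%:E * lebesgue_rV R n Q <=
   (1620 ^+ 2)%:E * (\int[lebesgue_rV R n]_(x in Q) `|x ord0 i|%:E *
     \int[lebesgue_rV R n]_(x in Q) `|x ord0 i|%:E))%E.
Proof.
case: n Q i => [|n] Q i mQ QM sQ cQ; first by case: i.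
pose s := tperm ord0 i.
pose Q' : set 'rV[R]_n.+1 := col_perm s @^-1` Q.
have mQ' : measurable Q' by rewrite -[Q']setTI; exact: measurable_col_perm.
have intE (phi : gR -> R) : measurable_fun setT phi -> (forall t, 0 <= phi t) ->
    (\int[lebesgue_rV R n.+1]_(x in Q) (phi (x ord0 i))%:E =
     \int[lebesgue_rV R n.+1]_(x in Q') (phi (x ord0 ord0))%:E)%E.
  move=> mphi phi0.
  pose m1 := measure_function_pushforward__canonical__measure_function_Measure
    (lebesgue_rV R n.+1) (measurable_col_perm s).
  transitivity (\int[m1]_(x in Q) (phi (x ord0 i))%:E)%E.
    by apply: eq_measure_integral => A mA _; exact/esym/lebesgue_rV_perm.
  rewrite (@ge0_integral_pushforward _ _ _ _ _ _ (measurable_col_perm s)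
    (lebesgue_rV R n.+1) Q)//; last first.
  - by move=> x _; rewrite lee_fin.
  - apply/measurable_EFinP; apply/measurable_funTS; apply: measurableT_comp mphi _.
    exact: measurable_rV_coord_fun.
  apply: eq_integral => x _; rewrite /= mxE; congr (phi (x _ _))%:E.
  by rewrite tpermR.
rewrite (intE (fun t => t ^+ 2)); 
  do ?[exact: measurable_funX|by move=> *; exact: sqr_ge0].
rewrite (intE (fun t => `|t|)); do ?[exact: measurableT_comp|by []].
rewrite -(lebesgue_rV_perm s mQ).
apply: (@moment_coord0 n Q' M) => //.
- move=> x /QM h j; have := h (s^-1%g j); by rewrite mxE permKV.
- move=> x y Qx yx; apply: sQ Qx _ => j; rewrite !mxE; exact: yx.
- move=> x y Qx Qy; have := cQ _ _ Qx Qy; rewrite /Q'/=; congr Q.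
  by apply/rowP => j; rewrite !mxE.
Qed.

End rV_moments.

(** * Volume and second moments *)

Section volume.
Variable R : realType.
Local Notation lam := (@lebesgue_measure R).
Local Notation gR := (measurableTypeR R).

Lemma measurable_prod_coord n (h : 'I_n -> gR -> R) :
  (forall i, measurable_fun setT (h i)) ->
  measurable_fun setT (fun x : 'rV[R]_n => \prod_i h i (x ord0 i)).
Proof.
move=> mh; apply: measurable_prod => i _.
by apply: measurableT_comp (mh i) _; exact: measurable_rV_coord_fun.
Qed.

Lemma integral_prod_coord n (h : 'I_n -> gR -> R) :
  (forall i, measurable_fun setT (h i)) -> (forall i t, 0 <= h i t) ->
  (forall i, (\int[lam]_t (h i t)%:E = 1)%E) ->
  (\int[lebesgue_rV R n]_x (\prod_i h i (x ord0 i))%:E = 1)%E.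
Proof.
elim: n h => [|n IH] h mh h0 h1.
  under eq_integral do rewrite big_ord0.
  by rewrite integral_cst//= diracE mem_set// mule1.
rewrite ge0_integral_rV_cons; do ?[by apply/measurable_EFinP; exact: measurable_prod_coord
  |by move=> *; rewrite lee_fin prodr_ge0].
rewrite -[RHS](h1 ord0); apply: eq_integral => t _.
transitivity (\int[lebesgue_rV R n]_v ((h ord0 t)%:E *
    (\prod_i h (lift ord0 i) (v ord0 i))%:E))%E.
  apply: eq_integral => v _; rewrite -EFinM big_ord_recl rV_cons0.
  by congr (_ * _)%:E; apply: eq_bigr => i _; rewrite rV_consS.
rewrite ge0_integralZl//; do ?[by apply/measurable_EFinP; exact: measurable_prod_coord
  |by move=> *; rewrite lee_fin ?prodr_ge0|by rewrite lee_fin].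
  by rewrite (IH (fun i => h (lift ord0 i))) ?mule1.
by apply/measurable_EFinP; apply: (measurable_prod_coord (h := fun i => h (lift ord0 i))).
Qed.

(** The factor 3 absorbs [sqrt (2 pi)], because [pi < 4] gives [2 pi < 9]. *)
Lemma normal_pdf_ge (s t : R) : 0 < s ->
  expR (- (t ^+ 2 / (2 * s ^+ 2))) <= 3 * s * normal_pdf 0 s t.
Proof.
move=> s0; rewrite normal_pdfE ?gt_eqF// /normal_fun subr0.
have -> : - t ^+ 2 / (s ^+ 2 *+ 2) = - (t ^+ 2 / (2 * s ^+ 2)).
  by rewrite mulNr -mulr_natl.
rewrite [leRHS]mulrA -[leLHS]mul1r ler_wpM2r ?expR_ge0// /normal_peak.
have p0 : 0 < Num.sqrt (s ^+ 2 * pi *+ 2).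
  by rewrite sqrtr_gt0 mulrn_wgt0// mulr_gt0 ?pi_gt0// exprn_gt0.
rewrite ler_pdivlMr// mul1r -(ler_pXn2r (n := 2)) ?nnegrE ?ltW// ?mulr_gt0//.
rewrite sqr_sqrtr; last by rewrite mulrn_wge0// mulr_ge0 ?pi_ge0// sqr_ge0.
have : 0 <= s ^+ 2 * (4 - pi).
  by rewrite mulr_ge0 ?sqr_ge0//; have := @pihalf_lt2 R; lra.
have -> : (3 * s) ^+ 2 = 9 * s ^+ 2 by ring.
rewrite mulrBr => pis; rewrite -[ltLHS]mulr_natr.
by have := exprn_gt0 2 s0; lra.
Qed.

(* Jensen's inequality for a Gaussian density: with S = sum_i x_i^2 / (2 s_i^2) the
   mean of n/2 - S over Q is nonnegative, so int_Q exp (n/2 - S) >= vol Q. *)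
Lemma volume_le_moments n (Q : set 'rV[R]_n) (s : 'I_n -> R) :
  measurable Q -> lebesgue_rV R n Q \is a fin_num -> (forall i, 0 < s i) ->
  (forall i, (\int[lebesgue_rV R n]_(x in Q) (x ord0 i ^+ 2)%:E <=
    (s i ^+ 2)%:E * lebesgue_rV R n Q)%E) ->
  (lebesgue_rV R n Q <= (6 ^+ n * \prod_i s i)%:E)%E.
Proof.
move=> mQ finQ s0 Hs.
pose P := \prod_i s i.
pose S (x : 'rV[R]_n) := \sum_i (x ord0 i ^+ 2 / (2 * s i ^+ 2)).
pose T (x : 'rV[R]_n) := expR (n%:R / 2 - S x).
have term0 i (x : 'rV[R]_n) : 0 <= x ord0 i ^+ 2 / (2 * s i ^+ 2).
  by rewrite divr_ge0 ?sqr_ge0// mulr_ge0// sqr_ge0.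
have mterm i : measurable_fun setT (fun x : 'rV[R]_n => x ord0 i ^+ 2 / (2 * s i ^+ 2)).
  apply: measurable_funM => //; apply: measurable_funX; exact: measurable_rV_coord_fun.
have mS : measurable_fun setT S by apply: measurable_sum => i; exact: mterm.
have S0 x : 0 <= S x by rewrite sumr_ge0.
have mT : measurable_fun setT T.
  by apply: measurableT_comp => //; exact: measurable_funB.
have T0 x : 0 <= T x by exact: expR_ge0.
(* The 6 per coordinate is [2 * 3]: [exp (1 / 2) <= 2], and 3 comes from [normal_pdf_ge]. *)
have Tpdf x : T x <= 6 ^+ n * P * \prod_i normal_pdf 0 (s i) (x ord0 i).
  have e2 : expR (2^-1) <= 2 :> R.
    have e0 := expR_gt0 (2^-1 : R).
    have := expR_ge1Dx (- 2^-1 : R); rewrite expRN -(ler_pM2r e0) mulVf ?gt_eqF//; lra.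
  rewrite /T expRD -mulr_natl mulr1 expRM_natl /S -sumrN expR_sum.
  have -> : 6 ^+ n * P * \prod_i normal_pdf 0 (s i) (x ord0 i) =
      2 ^+ n * \prod_i (3 * s i * normal_pdf 0 (s i) (x ord0 i)).
    rewrite !big_split/= prodr_const card_ord -/P !mulrA -exprMn.
    by congr (_ ^+ n * _ * _); ring.
  apply: ler_pM; rewrite ?exprn_ge0 ?expR_ge0 ?prodr_ge0//.
  - by apply: lerXn2r; rewrite ?nnegrE ?expR_ge0.
  - by apply: ler_prod => i _; rewrite expR_ge0/= normal_pdf_ge.
have intS : (\int[lebesgue_rV R n]_(x in Q) (S x)%:E <= (n%:R / 2)%:E * lebesgue_rV R n Q)%E.
  under eq_integral do rewrite /S -sumEFin.
  rewrite ge0_integral_sum//; last first.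
  - by move=> i x _; rewrite lee_fin.
  - by move=> i; apply/measurable_EFinP; exact: measurable_funTS.
  rewrite -(fineK finQ) -EFinM.
  have -> : n%:R / 2 * fine (lebesgue_rV R n Q) = \sum_(i < n) (2^-1 * fine (lebesgue_rV R n Q)).
    by rewrite sumr_const card_ord -[RHS]mulr_natl mulrA.
  rewrite -sumEFin; apply: lee_sum => i _.
  under eq_integral do rewrite mulrC EFinM.
  have k0 : 0 < 2 * s i ^+ 2 by rewrite mulr_gt0// exprn_gt0.
  rewrite ge0_integralZl//; last first.
  - by rewrite lee_fin invr_ge0 ltW.
  - by move=> x _; rewrite lee_fin sqr_ge0.
  - apply/measurable_EFinP; apply: measurable_funTS; apply: measurable_funX.
    exact: measurable_rV_coord_fun.
  apply: le_trans (_ : _ <= (2 * s i ^+ 2)^-1%:E * ((s i ^+ 2)%:E * lebesgue_rV R n Q))%E _.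
    by rewrite lee_pmul2l// lte_fin invr_gt0.
  rewrite -(fineK finQ) -!EFinM lee_fin fineK// mulrA ler_wpM2r ?fine_ge0//.
  by rewrite invfM mulfVK ?gt_eqF// exprn_gt0.
have intT : (\int[lebesgue_rV R n]_(x in Q) (T x)%:E <= (6 ^+ n * P)%:E)%E.
  have P0 : 0 <= 6 ^+ n * P by rewrite mulr_ge0 ?exprn_ge0// prodr_ge0// => i _; exact: ltW.
  rewrite -[leRHS]mule1.
  rewrite -(@integral_prod_coord n (fun i => normal_pdf 0 (s i))); last first.
  - by move=> i; exact: integral_normal_pdf.
  - by move=> i t; exact: normal_pdf_ge0.
  - by move=> i; exact: measurable_normal_pdf.
  have mpdf : measurable_fun setT (fun x : 'rV[R]_n => \prod_i normal_pdf 0 (s i) (x ord0 i)).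
    by apply: (measurable_prod_coord (h := fun i => normal_pdf 0 (s i))) => i;
      exact: measurable_normal_pdf.
  have pdf0 x : 0 <= \prod_i normal_pdf 0 (s i) ((x : 'rV[R]_n) ord0 i).
    by rewrite prodr_ge0// => i _; exact: normal_pdf_ge0.
  rewrite -ge0_integralZl//; do ?[exact/measurable_EFinP|by move=> *; rewrite lee_fin].
  apply: (@le_trans _ _ (\int[lebesgue_rV R n]_x (T x)%:E)%E).
    by apply: ge0_subset_integral => //; [exact/measurable_EFinP|move=> x _; rewrite lee_fin].
  apply: ge0_le_integral => //.
  - by move=> x _; rewrite lee_fin.
  - exact/measurable_EFinP.
  - by apply: measurable_funeM; exact/measurable_EFinP.
  - by move=> x _; rewrite -EFinM lee_fin.
(* Jensen enters as [1 + y <= exp y] with [y = n / 2 - S], integrated over [Q]. Keeping [S] on the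
   side of [T] leaves all integrands nonnegative, and [intS] then cancels the term [n / 2]. *)
have : ((1 + n%:R / 2)%:E * lebesgue_rV R n Q <=
   \int[lebesgue_rV R n]_(x in Q) (T x)%:E + \int[lebesgue_rV R n]_(x in Q) (S x)%:E)%E.
  rewrite -integral_cst// -ge0_integralD//; do ?[by move=> *; rewrite lee_fin
    |by apply/measurable_EFinP; exact: measurable_funTS].
  apply: ge0_le_integral => //.
  - by move=> x _; rewrite lee_fin addr_ge0// divr_ge0.
  - by apply/measurable_EFinP; apply: measurable_funTS; exact: measurable_funD.
  - move=> x _; rewrite -EFinD lee_fin.
    have := expR_ge1Dx (n%:R / 2 - S x); rewrite /T; lra.
move=> /le_trans/(_ (leeD intT intS)).
rewrite -(fineK finQ) -!EFinM -EFinD !lee_fin -/P; set c := 6 ^+ n * P; lra.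
Qed.

End volume.

(** * Large coordinates of points of the body *)

Section order_statistics.
Variables (R : realType) (n : nat) (Q : set 'rV[R]_n) (M d : R).
Local Notation lam := (@lebesgue_measure R).
Local Notation mu := (lebesgue_rV R n).
Hypotheses (mQ : measurable Q) (QM : Q `<=` rV_cube M) (sQ : solid Q).
Hypotheses (cQ : midconvex Q) (d0 : 0 < d) (dQ : rV_cube d `<=` Q).

Let finQ : mu Q \is a fin_num. Proof. exact: cube_fin_num QM. Qed.

Lemma lebesgue_rV_box_itv (a b : 'I_n -> R) : (forall i, a i <= b i) ->
  mu (rV_box (fun i => `[a i, b i]%classic)) = (\prod_i (b i - a i))%:E.
Proof.
move=> ab; rewrite lebesgue_rV_boxE//.
rewrite -prodEFin; apply: eq_bigr => i _.
have := @lebesgue_measure_itv R `[a i, b i]; rewrite /= lte_fin => ->.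
case: ltP => h; first by rewrite EFinB.
by congr (_%:E); apply/eqP; rewrite eq_sym subr_eq0 eq_le h ab.
Qed.

Lemma vol_gt0 : 0 < vol Q.
Proof.
have : (mu (rV_box (fun=> `[(- d)%R, d]%classic)) <= mu Q)%E.
  apply: le_measure; rewrite ?inE//; first exact: measurable_rV_box.
  by rewrite -rV_cubeE.
rewrite lebesgue_rV_box_itv; last by move=> _; rewrite ge0_cp// ltW.
rewrite -(fineK finQ) lee_fin; apply: lt_le_trans.
by apply: prodr_gt0 => i _; rewrite opprK addr_gt0.
Qed.

Let msq i : measurable_fun setT (fun x : 'rV[R]_n => x ord0 i ^+ 2).
Proof. by apply: measurable_funX; exact: measurable_rV_coord_fun. Qed.

Let mab i : measurable_fun setT (fun x : 'rV[R]_n => `|x ord0 i|).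
Proof. by apply: measurableT_comp => //; exact: measurable_rV_coord_fun. Qed.

Let fin_int (h : 'rV[R]_n -> R) K : measurable_fun setT h -> (forall x, 0 <= h x) ->
  (forall x, Q x -> h x <= K) -> (\int[mu]_(x in Q) (h x)%:E)%E \is a fin_num.
Proof.
move=> mh h0 hK.
rewrite ge0_fin_numE; last by apply: integral_ge0 => x _; rewrite lee_fin.
apply: (@le_lt_trans _ _ (\int[mu]_(x in Q) (cst K%:E) x)%E).
  apply: ge0_le_integral => //.
  - by move=> x _; rewrite lee_fin.
  - by apply/measurable_EFinP; exact: measurable_funTS.
by rewrite integral_cst// ltey_eq fin_numM.
Qed.

Lemma sigmaE i : (\int[mu]_(x in Q) (x ord0 i ^+ 2)%:E = (sigma Q i ^+ 2)%:E * mu Q)%E.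
Proof.
have V0 := vol_gt0.
have fI : (\int[mu]_(x in Q) (x ord0 i ^+ 2)%:E)%E \is a fin_num.
  apply: (@fin_int _ (M ^+ 2)) => // x; first exact: sqr_ge0.
  move=> /QM /(_ i) xM; rewrite -(real_normK (num_real _)) ler_pXn2r ?nnegrE//.
  exact: le_trans xM.
rewrite /sigma sqr_sqrtr; last first.
  apply: mulr_ge0; first by rewrite invr_ge0 ltW.
  apply: Rintegral_ge0 => x _; exact: sqr_ge0.
rewrite -(fineK finQ) -/(vol Q) -EFinM mulrC mulrA divff ?gt_eqF// mul1r.
by rewrite /Rintegral fineK.
Qed.

Lemma sigma_gt0 i : 0 < sigma Q i.
Proof.
(* A box inside [Q] of positive volume on which the [i]-th coordinate is at least [d / 2]. *)
pose a (j : 'I_n) := if j == i then d / 2 else - d.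
pose B : set 'rV[R]_n := rV_box (fun j => `[a j, d]%classic).
have ad j : a j < d by rewrite /a; case: ifP => _; have := d0; lra.
have mB : measurable B by apply: measurable_rV_box.
have B0 : (0 < mu B)%E.
  rewrite lebesgue_rV_box_itv => [|j]; last exact: ltW.
  by rewrite lte_fin prodr_gt0// => j _; rewrite subr_gt0.
have BQ : B `<=` Q.
  move=> x Bx; apply: dQ => j; have := Bx j; rewrite /= in_itv/= /a => /andP[].
  by case: ifP => _ h1 h2; rewrite ler_norml h2 andbT; have := d0; lra.
have : (0 < \int[mu]_(x in Q) (x ord0 i ^+ 2)%:E)%E.
  apply: (@lt_le_trans _ _ (\int[mu]_(x in B) (x ord0 i ^+ 2)%:E)%E); last first.
    apply: ge0_subset_integral => //; last by move=> x _; rewrite lee_fin sqr_ge0.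
    by apply/measurable_EFinP; exact: measurable_funTS.
  apply: (@lt_le_trans _ _ (\int[mu]_(x in B) (cst ((d / 2) ^+ 2)%:E) x)%E).
    by rewrite integral_cst// mule_gt0// lte_fin exprn_gt0// divr_gt0.
  apply: ge0_le_integral => //.
  - by move=> x _; rewrite lee_fin sqr_ge0.
  - by apply/measurable_EFinP; exact: measurable_funTS.
  - move=> x /(_ i); rewrite /= in_itv/= /a eqxx => /andP[h _].
    have d2 : 0 <= d / 2 by rewrite divr_ge0// ltW.
    by rewrite lee_fin ler_pXn2r ?nnegrE// (le_trans d2).
rewrite sigmaE -(fineK finQ) -EFinM lte_fin pmulr_lgt0; last exact: vol_gt0.
move=> s2; have s0 : 0 <= sigma Q i by exact: sqrtr_ge0.
rewrite lt_neqAle s0 andbT eq_sym; apply/eqP => s.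
by rewrite s expr0n/= ltxx in s2.
Qed.

(** The square root of [moment_coord]: the reverse Hoelder inequality between the first and second
    moments. *)
Lemma abs_moment_ge i : 
  ((sigma Q i * vol Q)%:E <= 1620%:E * \int[mu]_(x in Q) `|x ord0 i|%:E)%E.
Proof.
have fI : (\int[mu]_(x in Q) `|x ord0 i|%:E)%E \is a fin_num.
  by apply: (@fin_int _ M) => // x /QM.
have := moment_coord i mQ QM sQ cQ; rewrite sigmaE.
have I0 : 0 <= fine (\int[mu]_(x in Q) `|x ord0 i|%:E)%E.
  by rewrite fine_ge0// integral_ge0// => x _; rewrite lee_fin.
rewrite -(fineK finQ) -(fineK fI) -/(vol Q) -!EFinM !lee_fin.
have sq_le (s V k I : R) : 0 <= s -> 0 <= V -> 0 <= k -> 0 <= I ->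
    s ^+ 2 * V * V <= k ^+ 2 * (I * I) -> s * V <= k * I.
  move=> s0 V0 k0 I0'; rewrite -mulrA -!expr2 -!exprMn ler_pXn2r// ?nnegrE; exact: mulr_ge0.
apply: sq_le I0; [exact: sqrtr_ge0|exact/ltW/vol_gt0|exact: ler0n].
Qed.

Lemma volume_le_sigma : vol Q <= 6 ^+ n * \prod_i sigma Q i.
Proof.
rewrite -lee_fin fineK//; apply: volume_le_moments => // i; first exact: sigma_gt0.
by rewrite sigmaE.
Qed.

End order_statistics.

Section large_coordinates.
Variables (R : realType) (n : nat) (Q : set 'rV[R]_n) (M d : R).
Local Notation mu := (lebesgue_rV R n).
Hypotheses (mQ : measurable Q) (QM : Q `<=` rV_cube M) (sQ : solid Q).
Hypotheses (cQ : midconvex Q) (d0 : 0 < d) (dQ : rV_cube d `<=` Q).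
Variables (a : 'rV[R]_n) (p : R) (b : 'I_n -> R).
Hypotheses (Qa : Q a) (p0 : 0 < p) (ap : forall i, a ord0 i = p * sigma Q i).
Hypotheses (b1 : forall x, Q x -> \sum_i b i * x ord0 i <= 1).
Hypothesis ba1 : \sum_i b i * a ord0 i = 1.

Let a0 i : 0 < a ord0 i.
Proof. by rewrite ap mulr_gt0// (@sigma_gt0 _ _ _ M d). Qed.

Let finQ : mu Q \is a fin_num. Proof. exact: cube_fin_num QM. Qed.

(** Flipping the sign of the [i]-th coordinate of [a] stays in [Q], where the functional is at most
    1, its value at [a]. Hence [b i * a i >= 0]. *)
Lemma norming_coef_ge0 i : 0 <= b i.
Proof.
pose x : 'rV[R]_n := \row_j (if j == i then - a ord0 j else a ord0 j).
have Qx : Q x.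
  by apply: sQ Qa _ => j; rewrite mxE; case: ifP; rewrite ?normrN.
have := b1 Qx; rewrite -ba1 (bigD1 i)//= [in leRHS](bigD1 i)//= mxE eqxx.
rewrite (eq_bigr (fun j => b j * a ord0 j)); last first.
  by move=> j ji; rewrite mxE (negbTE ji).
rewrite lerD2r mulrN => h.
by rewrite -(pmulr_lge0 _ (a0 i)); lra.
Qed.

(** Integrate [sum_i b_i |x_i| <= 1] over [Q]. By [abs_moment_ge] the left side is at least
    [vol Q / 1620] times [sum_i b_i sigma_i], and this sum is [1 / p] because the functional is 1 at
    [a = p sigma]. *)
Lemma apex_scale_ge : 1 <= 1620 * p.
Proof.
have V0 : 0 < vol Q by exact: (@vol_gt0 _ _ _ M d).
have mab i : measurable_fun Q (fun x : 'rV[R]_n => `|x ord0 i|%:E).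
  apply/measurable_EFinP; apply: measurable_funTS; apply: measurableT_comp => //.
  exact: measurable_rV_coord_fun.
have sb : \sum_i b i * (p * sigma Q i) = 1.
  by rewrite -ba1; apply: eq_bigr => i _; rewrite ap.
have amg i := @abs_moment_ge _ _ _ M d mQ QM sQ cQ d0 dQ i.
have k0 : 0 <= 1620 :> R by exact: ler0n.
move: (1620 : R) amg k0 => k amg k0.
have : (\sum_i (b i)%:E * (sigma Q i * vol Q)%:E <= k%:E * mu Q)%E.
  apply: (@le_trans _ _ (\sum_i (k%:E * ((b i)%:E * \int[mu]_(x in Q) `|x ord0 i|%:E)))%E).
    apply: lee_sum => i _; rewrite muleCA lee_wpmul2l//.
      by rewrite lee_fin norming_coef_ge0.
  rewrite -ge0_sume_distrr; last first.
    move=> i _; rewrite mule_ge0// ?lee_fin ?norming_coef_ge0//.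
    by apply: integral_ge0 => x _; rewrite lee_fin.
  rewrite lee_wpmul2l//.
  under eq_bigr => i _ do rewrite -ge0_integralZl_EFin ?norming_coef_ge0//.
  rewrite -ge0_integral_sum//; last first.
  - by move=> i x _; rewrite mule_ge0// lee_fin// norming_coef_ge0.
  - by move=> i; apply: measurable_funeM.
  rewrite -[leRHS]mul1e -integral_cst//; apply: ge0_le_integral => //.
  - by move=> x _; rewrite sume_ge0// => i _; rewrite mule_ge0// lee_fin// norming_coef_ge0.
  - by apply: emeasurable_sum => i; exact: measurable_funeM.
  - move=> x Qx; under eq_bigr do rewrite -EFinM; rewrite sumEFin lee_fin.
    have Qabs : Q (\row_i `|x ord0 i|).
      by apply: sQ Qx _ => i; rewrite mxE normr_id.
    by have := b1 Qabs; under eq_bigr do rewrite mxE.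
under eq_bigr do rewrite -EFinM.
rewrite sumEFin -(fineK finQ) -EFinM lee_fin -/(vol Q).
have -> : \sum_i b i * (sigma Q i * vol Q) = p^-1 * vol Q.
  rewrite -[p^-1]mulr1 -sb mulr_sumr mulr_suml; apply: eq_bigr => i _.
  by field; exact: lt0r_neq0.
by rewrite ler_pM2r// -ler_pdivrMr// mul1r.
Qed.

(** The midpoint of [(|f_i|)_i] and [a] lies in [Q]; by solidity so does the symmetric box that it
    spans, whose volume is the left side. *)
Lemma box_volume_le f : Q f ->
  \prod_i (`|f ord0 i| + a ord0 i) <= 6 ^+ n * \prod_i sigma Q i.
Proof.
move=> Qf.
pose c i := (`|f ord0 i| + a ord0 i) / 2.
have c0 i : 0 <= c i by rewrite divr_ge0// addr_ge0// ltW.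
have Qc : Q (2^-1 *: ((\row_i `|f ord0 i|) + a)).
  by apply: cQ => //; apply: sQ Qf _ => i; rewrite mxE normr_id.
have sub : rV_box (fun i => `[- c i, c i]%classic) `<=` Q.
  move=> x Bx; apply: sQ Qc _ => i; rewrite !mxE.
  have := Bx i; rewrite /= in_itv/= -ler_norml => /le_trans; apply.
  by rewrite mulrC ler_norm.
apply: (@le_trans _ _ (vol Q)); last by apply: (@volume_le_sigma _ _ _ M d).
rewrite -lee_fin fineK//.
rewrite (_ : \prod_i _ = \prod_i (c i - - c i)); last first.
  by apply: eq_bigr => i _; rewrite /c; field.
rewrite -lebesgue_rV_box_itv; last by move=> i; rewrite ge0_cp.
by apply: le_measure sub; rewrite inE//; exact: measurable_rV_box.
Qed.

(** 6 is the constant of [volume_le_sigma] and 1620 that of [apex_scale_ge]. The cube matches the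
    proportion 1/3 in [card_large_coord], and [+ 1] makes the final comparison there strict. *)
Definition order_const : R := (6 * 1620) ^+ 3 + 1.

Lemma order_const_ge1 : 1 <= order_const.
Proof.
rewrite /order_const; have := ler0n R 1620; move: (1620 : R) => c c0.
by rewrite lerDr exprn_ge0// mulr_ge0.
Qed.

(* The box with half-sides (|f_i| + a_i) / 2 lies in Q; too many large f_i would
   contradict the volume bound. *)
Lemma card_large_coord f : Q f -> (0 < n)%N ->
  (3 * #|[pred i | (order_const * a ord0 i <= `|f ord0 i|)%R]| < n)%N.
Proof.
move=> Qf n0; rewrite ltnNge; apply/negP.
set I := [pred i | _] => nI.
have [c [cp c1 DE]] : exists c : R, [/\ 1 <= c * p, 1 <= c & order_const = (6 * c) ^+ 3 + 1].
  by exists 1620; split; [exact: apex_scale_ge|rewrite ler1n|].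
pose k := 6 * c.
have k1 : 1 <= k by rewrite /k; lra.
have D1 : 1 <= order_const by rewrite DE lerDr exprn_ge0// (le_trans ler01).
have P0 : 0 < \prod_i sigma Q i.
  by apply: prodr_gt0 => i _; exact: (@sigma_gt0 _ _ _ M d).
(* In [box_volume_le] each index of [I] contributes at least [order_const * a_i] and every other
   index at least [a_i = p sigma_i]; the product of the [sigma_i] cancels. *)
have lb : order_const ^+ #|I| * p ^+ n <= 6 ^+ n.
  rewrite -(ler_pM2r P0); apply: le_trans (box_volume_le Qf).
  have -> : p ^+ n = \prod_(i < n) p by rewrite prodr_const card_ord.
  rewrite -mulrA -big_split/= -prodr_const big_mkcond/= -big_split/=.
  apply: ler_prod => i _; rewrite -ap; case: ifP => [iI|_].
    apply/andP; split; first by apply: mulr_ge0; [exact: le_trans D1|exact: ltW].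
    by move: iI; rewrite inE => /le_trans; apply; rewrite lerDl; exact: ltW.
  by rewrite mul1r lerDr normr_ge0 andbT; exact: ltW.
have : order_const ^+ #|I| <= k ^+ n.
  apply: le_trans (_ : _ <= order_const ^+ #|I| * (c * p) ^+ n) _.
    rewrite ler_peMr ?exprn_ge0 ?(le_trans ler01)//.
    exact: exprn_ege1.
  by rewrite exprMn mulrCA /k mulrC exprMn ler_wpM2r// exprn_ge0// (le_trans ler01).
move=> H.
(* Since [n <= 3 |I|], cubing gives [order_const <= k ^ 3], against its definition. *)
have : order_const ^+ n <= (k ^+ 3) ^+ n.
  apply: le_trans (_ : _ <= order_const ^+ (3 * #|I|)) _; first exact: ler_weXn2l.
  rewrite mulnC exprM [leRHS]exprAC; apply: lerXn2r => //; rewrite nnegrE exprn_ge0//.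
  - exact: le_trans D1.
  - exact: le_trans k1.
rewrite ler_pXn2r ?nnegrE ?exprn_ge0 ?(le_trans ler01)//.
by rewrite DE -/k gerDl ler10.
Qed.

End large_coordinates.

(** * Unconditional convex bodies *)

Section convexity.
Variable R : realType.

Lemma convex_setP (V : lmodType R) (A : set V) :
  @convex_set R V A <->
  forall x y t, A x -> A y -> 0 <= t -> t <= 1 -> A (t *: x + (1 - t) *: y).
Proof.
split=> [cA x y t Ax Ay t0 t1|cA x y t /set_mem Ax /set_mem Ay].
  have := cA x y (Itv01 t0 t1) (mem_set Ax) (mem_set Ay).
  by move=> /set_mem.
apply: mem_set; exact: cA.
Qed.

Lemma convex_midconvex n (Q : set 'rV[R]_n) : @convex_set R 'rV[R]_n Q -> midconvex Q.
Proof.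
move=> /convex_setP cQ x y Qx Qy; have := cQ x y 2^-1 Qx Qy.
have -> : 1 - 2^-1 = 2^-1 :> R by field.
rewrite -scalerDr; apply; lra.
Qed.

(** The coordinates of [x] are replaced by those of [y] one at a time. Each replacement is a convex
    combination of the current point and its reflection in that coordinate. *)
Lemma unconditional_solid n (Q : set 'rV[R]_n) :
  @convex_set R 'rV[R]_n Q -> unconditional Q -> solid Q.
Proof.
move=> /convex_setP cQ uQ x y Qx yx.
pose z k : 'rV[R]_n := \row_i (if (i < k)%N then y ord0 i else x ord0 i).
suff H k : Q (z k).
  have -> : y = z n by apply/rowP => i; rewrite mxE ltn_ord.
  exact: H.
elim: k => [|k IH].
  suff -> : z 0%N = x by [].
  by apply/rowP => i; rewrite mxE.
have [kn|nk] := ltnP k n; last first.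
  suff -> : z k.+1 = z k by [].
  apply/rowP => i; rewrite !mxE; have ik : (i < k)%N by apply: leq_trans nk.
  by rewrite ik ltnW.
pose j := Ordinal kn.
have Qr : Q (sign_change (fun i => i == j) (z k)).
  by rewrite -(uQ (fun i => i == j)); exists (z k).
have [xj|xj] := eqVneq (x ord0 j) 0.
  suff -> : z k.+1 = z k by [].
  apply/rowP => i; rewrite !mxE ltnS leq_eqVlt.
  have [ik|//] := eqVneq (i : nat) k; have -> : i = j by exact: val_inj.
  by rewrite /= ltnn xj; apply/eqP; rewrite -normr_le0 -(normr0 R) -xj.
(* The solution of [t x_j - (1 - t) x_j = y_j]. *)
pose t := (1 + y ord0 j / x ord0 j) / 2.
have : `|y ord0 j / x ord0 j| <= 1.
  by rewrite normrM normfV ler_pdivrMr ?normr_gt0// mul1r.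
rewrite ler_norml => /andP[t0 t1].
suff -> : z k.+1 = t *: z k + (1 - t) *: sign_change (fun i => i == j) (z k).
  by apply: cQ => //; rewrite /t; lra.
apply/rowP => i; rewrite !mxE ltnS leq_eqVlt.
have [->|ij] := eqVneq i j.
  by rewrite /= eqxx ltnn expr1 /t; field.
have /negbTE -> : (i : nat) != k by [].
by rewrite /= expr0 mul1r -mulrDl addrC subrK mul1r.
Qed.

(** For the lower inclusion let [x] be an interior point. For small [z] both [x + z] and [z - x],
    the reflection of [x - z], lie in [Q], and their midpoint is [z]. *)
Lemma body_bounds n (Q : set 'rV[R]_n) : convex_body Q -> unconditional Q ->
  exists M d, [/\ 0 < d, Q `<=` rV_cube M & rV_cube d `<=` Q].
Proof.
move=> [cpQ cQ [x xQ]] uQ.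
have sQ := unconditional_solid cQ uQ; have mcQ := convex_midconvex cQ.
have [M [_ HM]] := compact_bounded cpQ.
have /nbhs_ballP[e /= e0 xeQ] : nbhs x Q by exact: xQ.
exists (M + 1), (e / 2); split; first by rewrite divr_gt0.
  have M1 : M < M + 1 by rewrite ltrDl.
  move=> z Qz i; have := HM _ M1 z Qz.
  apply: le_trans; rewrite [leRHS]/Num.norm /= mx_normrE; apply/bigmax_geP; right => /=.
  by exists (ord0, i).
move=> z zd.
have near (w : 'rV[R]_n) : (forall i, `|w ord0 i| <= e / 2) -> Q (x + w).
  move=> we; apply: xeQ; split=> // i j; rewrite ord1 /ball/= mxE.
  by rewrite opprD addrA subrr sub0r normrN (le_lt_trans (we j))//; lra.
have Q1 : Q (x + z) by exact: near.
have Q2 : Q (z - x).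
  have : Q (x - z) by apply: near => i; rewrite mxE normrN.
  by move=> /sQ; apply => i; rewrite !mxE distrC.
by have := mcQ _ _ Q1 Q2; congr Q; apply/rowP => i; rewrite !mxE; field.
Qed.

Lemma body_closed n (Q : set 'rV[R]_n) : convex_body Q -> closed Q.
Proof. by move=> [cpQ _ _]; apply: compact_closed => //; exact: norm_hausdorff. Qed.

End convexity.

(** * The apex and the norming functional *)

Section norming_functional.
Variables (R : realType) (n : nat) (Q : set 'rV[R]_n) (lhat : {scalar 'rV[R]_n}).
Hypotheses (bQ : convex_body Q) (uQ : unconditional Q) (nQ : norming Q lhat).

Let mQ : measurable Q. Proof. apply: closed_measurable_rV; exact: body_closed bQ. Qed.

Let sQ : solid Q. Proof. by apply: unconditional_solid => //; case: bQ. Qed.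

Lemma body_sigma_gt0 i : 0 < sigma Q i.
Proof. by have [M [d [d0 QM dQ]]] := body_bounds bQ uQ; apply: (@sigma_gt0 _ _ _ M d). Qed.

Lemma Lambda_unit : Lambda Q \in unitmx.
Proof.
rewrite unitmxE det_diag unitfE prodf_seq_neq0; apply/allP => i _ /=.
by rewrite mxE invr_eq0 gt_eqF// body_sigma_gt0.
Qed.

Let p := (body_norm (hat Q) (const_mx 1))^-1.

Lemma mul_LambdaE (x : 'rV[R]_n) i : (x *m Lambda Q) ord0 i = x ord0 i / sigma Q i.
Proof. by rewrite /Lambda mul_mx_diag !mxE. Qed.

Lemma apexE i : apex Q ord0 i = p * sigma Q i.
Proof.
have -> : apex Q = \row_j (p * sigma Q j).
  rewrite -[RHS](mulmxK Lambda_unit) /apex; congr (_ *m _).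
  apply/rowP => j; rewrite mul_LambdaE !mxE mulfK ?mulr1// gt_eqF//.
  exact: body_sigma_gt0.
by rewrite mxE.
Qed.

(** The gauge is nonnegative, also when its set of radii has no infimum and [inf] defaults to 0. If
    [p] were 0, [hat_apex] would be 0 and [lhat] could not take the value 1 there. *)
Lemma apex_scale_gt0 : 0 < p.
Proof.
have q0 : 0 <= body_norm (hat Q) (const_mx 1).
  rewrite /body_norm; set S := [set a | _].
  have [[x Sx]|nS] := pselect (S !=set0).
    by apply: lb_le_inf; [exists x|move=> a [/ltW]].
  by rewrite inf_out// => -[].
rewrite lt_neqAle invr_ge0 q0 andbT eq_sym; apply/eqP => p0.
have := nQ.2; rewrite /hat_apex -/p p0 scale0r linear0 => /esym/eqP.
by rewrite oner_eq0.
Qed.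

Lemma apex_gt0 i : 0 < apex Q ord0 i.
Proof. by rewrite apexE mulr_gt0 ?apex_scale_gt0 ?body_sigma_gt0. Qed.

(** The infimum in the gauge need not be attained a priori, so [t a] is placed in [Q] for all
    [0 < t < 1] first, and closedness of [Q] gives [a]. *)
Lemma apex_in : Q (apex Q).
Proof.
have scaled t : 0 < t -> t < 1 -> Q (t *: apex Q).
  move=> t0 t1.
  have q0 : 0 < body_norm (hat Q) (const_mx 1) by rewrite -invr_gt0 apex_scale_gt0.
  have : body_norm (hat Q) (const_mx 1) < body_norm (hat Q) (const_mx 1) / t.
    by rewrite ltr_pdivlMr// gtr_pMr.
  rewrite {1}/body_norm; set S := [set a | _] => qt.
  have S0 : S !=set0.
    apply: contrapT => /set0P/negP; rewrite negbK => /eqP S0.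
    by move: q0; rewrite /body_norm -/S S0 inf0 ltxx.
  have [b [b0 [_ [x Qx <-] /rowP bx]] bq] := inf_lt S0 qt.
  apply: sQ Qx _ => i; have := bx i; rewrite mxE [in RHS]mxE mul_LambdaE => xi.
  have s0 := body_sigma_gt0 i.
  have -> : x ord0 i = sigma Q i / b.
    apply: (canRL (mulfK (lt0r_neq0 b0))).
    by rewrite -[RHS]mul1r xi; field; exact: lt0r_neq0.
  have tb : t * p <= b^-1.
    rewrite -(ler_pM2r b0) mulVf ?lt0r_neq0// /p mulrAC ler_pdivrMr// mul1r.
    by rewrite mulrC; apply: ltW; rewrite -ltr_pdivlMr.
  rewrite mxE apexE !gtr0_norm ?mulr_gt0 ?invr_gt0// ?apex_scale_gt0//.
  by rewrite mulrA [leRHS]mulrC ler_pM2r.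
apply: (body_closed bQ) => B /nbhs_ballP[e /= e0 eB].
pose K := 1 + \sum_i apex Q ord0 i.
have K1 : 1 <= K by rewrite lerDl sumr_ge0// => i _; exact/ltW/apex_gt0.
have K0 : 0 < K by exact: lt_le_trans K1.
(* Chosen so that [(1 - t) a_j <= e / 2] for all [j], while [t >= 1 / 2]. *)
pose t := 1 - Num.min (e / (2 * K)) 2^-1.
have m0 : 0 < Num.min (e / (2 * K)) 2^-1.
  by rewrite lt_min invr_gt0 ltr0n andbT divr_gt0// mulr_gt0.
have m2 : Num.min (e / (2 * K)) 2^-1 <= 2^-1 by rewrite ge_min lexx orbT.
exists (t *: apex Q); split; first by apply: scaled; rewrite /t; lra.
apply: eB; split=> // i j; rewrite ord1 {i}.
change (`|apex Q ord0 j - (t *: apex Q) ord0 j| < e).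
rewrite [X in _ - X]mxE.
have -> : apex Q ord0 j - t * apex Q ord0 j = Num.min (e / (2 * K)) 2^-1 * apex Q ord0 j.
  by rewrite /t; ring.
rewrite gtr0_norm ?mulr_gt0 ?apex_gt0//.
have jK : apex Q ord0 j <= K.
  rewrite /K (bigD1 j)//= addrCA lerDl addr_ge0// sumr_ge0// => k _.
  exact/ltW/apex_gt0.
apply: (@le_lt_trans _ _ (e / (2 * K) * K)).
  apply: ler_pM => //; [exact: ltW|exact/ltW/apex_gt0|by rewrite ge_min lexx].
have -> : e / (2 * K) * K = e / 2 by field; exact: lt0r_neq0.
lra.
Qed.

Lemma lhat_le1 (x : 'rV[R]_n) : Q x -> `|ell Q lhat x| <= 1.
Proof.
move=> Qx; have [dn _] := nQ.
(* [sup] defaults to 0 when there is no supremum, so the dual norm 1 is a genuine supremum. *)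
have hs : has_sup [set `|lhat z| | z in hat Q].
  apply: contrapT => ns; move: dn; rewrite /dual_norm (sup_out ns) => /esym/eqP.
  by rewrite oner_eq0.
rewrite -dn; apply: (sup_upper_bound hs); exists (x *m Lambda Q) => //.
by exists x.
Qed.

Lemma ellD (x y : 'rV[R]_n) : ell Q lhat (x + y) = ell Q lhat x + ell Q lhat y.
Proof. by rewrite /ell mulmxDl linearD. Qed.

Lemma ellZ (c : R) (x : 'rV[R]_n) : ell Q lhat (c *: x) = c * ell Q lhat x.
Proof. by rewrite /ell -scalemxAl linearZ. Qed.

Lemma ell_apex : ell Q lhat (apex Q) = 1.
Proof. by rewrite /ell /apex mulmxKV ?Lambda_unit//; case: nQ. Qed.

Lemma ellE (x : 'rV[R]_n) :
  ell Q lhat x = \sum_i ell Q lhat (delta_mx ord0 i) * x ord0 i.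
Proof.
rewrite {1}[x]row_sum_delta.
elim/big_rec2: _ => [|i u v _ <-]; first by rewrite /ell mul0mx linear0.
by rewrite ellD ellZ mulrC.
Qed.

Lemma card_large_coord_body f : Q f -> (0 < n)%N ->
  (3 * #|[pred i | (order_const R * apex Q ord0 i <= `|f ord0 i|)%R]| < n)%N.
Proof.
have [M [d [d0 QM dQ]]] := body_bounds bQ uQ.
have [_ cQ _] := bQ.
apply: (@card_large_coord _ _ Q M d mQ QM sQ (convex_midconvex cQ) d0 dQ (apex Q) p
  (fun i => ell Q lhat (delta_mx ord0 i))).
- exact: apex_in.
- exact: apex_scale_gt0.
- exact: apexE.
- by move=> x Qx; rewrite -ellE (le_trans (ler_norm _))// lhat_le1.
- by rewrite -ellE ell_apex.
Qed.

End norming_functional.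

(** * Geometry of the cone *)

Section cone_geometry.
Variables (R : realType) (n : nat) (Q : set 'rV[R]_n) (lhat : {scalar 'rV[R]_n}).
Hypotheses (bQ : convex_body Q) (uQ : unconditional Q) (nQ : norming Q lhat).
Variables (L r : R).
Local Notation a := (apex Q).
Local Notation l := (ell Q lhat).
Local Notation F := (central_section Q lhat).
Local Notation K := (diagonal_cone Q lhat L r).

Let sQ : solid Q. Proof. by apply: unconditional_solid => //; case: bQ. Qed.

Let cQ x y t : Q x -> Q y -> 0 <= t -> t <= 1 -> Q (t *: x + (1 - t) *: y).
Proof. by case: bQ => _ /convex_setP h _; exact: h. Qed.

Let Q0 : Q 0.
Proof. by apply: sQ (apex_in bQ uQ nQ) _ => i; rewrite mxE normr0. Qed.

Let F0 : F 0.
Proof. by split=> //=; rewrite /ell mul0mx linear0. Qed.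

Definition cone_point t (f : 'rV[R]_n) := t *: (L *: a + r *: f).

(** The right-hand set is convex: heights [t], [t'] combine to [T = s t + (1 - s) t'] and base
    points to their average with weight [s t / T]. Conversely, each of its points lies on a segment
    from 0 to the base. *)
Lemma coneE : K = [set x | exists t f, [/\ 0 <= t, t <= 1, F f & x = cone_point t f]].
Proof.
rewrite /diagonal_cone /convex_hull; apply/seteqP; split.
  apply: smallest_sub.
    apply/convex_setP => _ z s [t [f [t0 t1 [Qf /= lf] ->]]].
    move=> [t' [f' [t'0 t'1 [Qf' /= lf'] ->]]] {z} s0 s1.
    pose T := s * t + (1 - s) * t'.
    have st0 : 0 <= s * t by rewrite mulr_ge0.
    have st'0 : 0 <= (1 - s) * t' by rewrite mulr_ge0// subr_ge0.
    have [T0|T0] := eqVneq T 0.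
      have e1 : s * t = 0 by move: T0; rewrite /T; lra.
      have e2 : (1 - s) * t' = 0 by move: T0; rewrite /T; lra.
      exists 0, 0; split=> //.
      by rewrite /cone_point !scalerA e1 e2 !scale0r addr0.
    have Tp : 0 < T by rewrite lt_neqAle eq_sym T0 /T addr_ge0.
    exists T, ((s * t / T) *: f + (1 - s * t / T) *: f'); split.
    - exact: ltW.
    - have h1 : s * t <= s by rewrite ler_piMr.
      have h2 : (1 - s) * t' <= 1 - s by rewrite ler_piMr// subr_ge0.
      by rewrite /T; lra.
    - split; first by apply: cQ => //; [rewrite divr_ge0// ltW|rewrite ler_pdivrMr// mul1r lerDl].
      by rewrite /= ellD !ellZ lf lf' !mulr0 addr0.
    - apply/rowP => i; rewrite /cone_point !mxE /T; field.
      exact: T0.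
  move=> _ [->|[f Ff <-]].
    by exists 0, 0; split=> //; rewrite /cone_point scale0r.
  by exists 1, f; split=> //; rewrite /cone_point scale1r.
move=> _ [t [f [t0 t1 Ff ->]]] A [cA HA].
have A0 : A 0 by apply: HA; left.
have A1 : A (L *: a + r *: f) by apply: HA; right; exists f.
move/convex_setP: cA => cA; have := cA _ _ t A1 A0 t0 t1.
by rewrite scaler0 addr0.
Qed.

Hypotheses (r0 : 0 < r) (rL : r <= L).

Let L0 : 0 < L. Proof. exact: lt_le_trans rL. Qed.

(** LEMMAPLACEHOLDER *)
Lemma cone_contains_translate : [set (L / 2) *: a + (r / 8) *: x | x in Q] `<=` K.
Proof.
move=> _ [z Qz <-]; rewrite coneE.
have := lhat_le1 nQ Qz; rewrite ler_norml => /andP[z1 z2].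
pose t := 1 / 2 + r / (8 * L) * l z.
have rL8 : 0 < r / (8 * L) by rewrite divr_gt0// mulr_gt0.
have rL8' : r / (8 * L) <= 1 / 8.
  rewrite ler_pdivrMr ?mulr_gt0//.
  by have -> : 1 / 8 * (8 * L) = L by field.
have t1 : 3 / 8 <= t.
  have : - (r / (8 * L)) <= r / (8 * L) * l z by rewrite -mulrN1 ler_wpM2l// ltW.
  by rewrite /t; lra.
have t2 : t <= 5 / 8.
  have : r / (8 * L) * l z <= r / (8 * L) by rewrite ler_piMr// ltW.
  by rewrite /t; lra.
have tp : 0 < t by lra.
have Qa := apex_in bQ uQ nQ.
pose g : 'rV[R]_n := 2^-1 *: (z - l z *: a).
have Qg : Q g.
  rewrite /g scalerDr; have -> : 2^-1 = 1 - 2^-1 :> R by field.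
  rewrite -[X in (1 - X) *: z](_ : 1 - 2^-1 = _); last by field.
  have -> : 1 - (1 - 2^-1) = 2^-1 :> R by field.
  apply: cQ => //; last by lra.
  apply: sQ Qa _ => i; rewrite !mxE normrN normrM ler_piMl//.
  exact: lhat_le1.
have lg : l g = 0.
  by rewrite /g ellZ ellD -scaleN1r !ellZ (ell_apex bQ uQ nQ) mulr1 mulN1r subrr mulr0.
exists t, ((4 * t)^-1 *: g); split; [lra|lra| |].
  split; last by rewrite /= ellZ lg mulr0.
  have -> : (4 * t)^-1 *: g = (4 * t)^-1 *: g + (1 - (4 * t)^-1) *: 0 by rewrite scaler0 addr0.
  apply: cQ => //; first by rewrite invr_ge0 mulr_ge0// ltW.
  by rewrite invf_le1 ?mulr_gt0//; lra.
have tE : t * L = L / 2 + r / 8 * l z by rewrite /t; field; exact: lt0r_neq0.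
have tn0 : t != 0 by exact: lt0r_neq0.
rewrite /cone_point /g; move: (apex Q) (l z) tE => b c; move: (t) tn0 => t' tn0 tE.
rewrite scalerDr scalerA tE; apply/rowP => i; rewrite !mxE; field.
exact: tn0.
Qed.

Lemma cone_sub : K `<=` [set (L + r) *: x | x in Q].
Proof.
rewrite coneE => _ [t [f [t0 t1 [Qf _] ->]]].
have Lr : 0 < L + r by rewrite addr_gt0.
exists ((L + r)^-1 *: cone_point t f); last first.
  by rewrite scalerA mulfV ?scale1r// lt0r_neq0.
have Qc : Q (L / (L + r) *: a + (1 - L / (L + r)) *: f).
  apply: cQ => //; first exact: (apex_in bQ uQ nQ).
    by rewrite divr_ge0// ltW.
  by rewrite ler_pdivrMr// mul1r lerDl ltW.
have -> : (L + r)^-1 *: cone_point t f =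
    t *: (L / (L + r) *: a + (1 - L / (L + r)) *: f) + (1 - t) *: 0.
  rewrite /cone_point; move: (apex Q) => b.
  by apply/rowP => i; rewrite !mxE; field; exact: lt0r_neq0.
exact: cQ.
Qed.

Lemma cone_star c x : 0 <= c -> c <= 1 -> K x -> K (c *: x).
Proof.
rewrite coneE => c0 c1 [t [f [t0 t1 Ff ->]]]; exists (c * t), f; split=> //.
- by rewrite mulr_ge0.
- by rewrite mulr_ile1.
- by rewrite /cone_point scalerA.
Qed.

Lemma ell_continuous : continuous (fun x : 'rV[R]_n => l x).
Proof.
have -> : (fun x : 'rV[R]_n => l x) =
    (fun x => \sum_i l (delta_mx ord0 i) * x ord0 i).
  by apply/funext => x; exact: ellE.
apply: continuous_big => [|i _ x]; first exact: add_continuous.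
apply: (@continuousM _ _ (cst (l (delta_mx ord0 i))) (fun y : 'rV[R]_n => y ord0 i)).
  exact: cst_continuous.
exact: coord_continuous.
Qed.

Lemma cone_compact : compact K.
Proof.
have cF : compact F.
  have [cpQ _ _] := bQ.
  apply: subclosed_compact cpQ _; last by move=> x [].
  apply: closedI; first exact: body_closed bQ.
  have -> : [set x | l x = 0] = l @^-1` [set 0] by [].
  apply: closed_comp; last exact: closed_eq.
  by move=> x _; exact: ell_continuous.
have -> : K = (fun p : R * 'rV[R]_n => cone_point p.1 p.2) @` (`[0, 1] `*` F).
  rewrite coneE; apply/seteqP; split=> x /=.
    by move=> [t [f [t0 t1 Ff ->]]]; exists (t, f) => //; split=> //=; rewrite in_itv/= t0.
  by move=> [[t f] [/=]]; rewrite in_itv/= => /andP[t0 t1] Ff <-; exists t, f.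
apply: continuous_compact; last by apply: compact_setX => //; exact: segment_compact.
apply: continuous_subspaceT => p.
rewrite /cone_point; apply: cvgZ; first exact: cvg_fst.
apply: cvgD; first exact: cvg_cst.
apply: cvgZ; first exact: cvg_cst.
exact: cvg_snd.
Qed.

Section counting.
Local Notation D := (order_const R).
Let eps := D * r / L.

Let a0 i : 0 < a ord0 i. Proof. exact: apex_gt0 bQ uQ nQ i. Qed.

Hypothesis n0 : (0 < n)%N.

Lemma cone_point_small t (f : 'rV[R]_n) i : `|f ord0 i| < D * a ord0 i -> 0 < t ->
  t * (1 - eps) * (L * a ord0 i) < (cone_point t f) ord0 i < t * (1 + eps) * (L * a ord0 i).
Proof.
move=> fi t0; have -> : (cone_point t f) ord0 i = t * (L * a ord0 i + r * f ord0 i).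
  by rewrite /cone_point; move: (apex Q) => b; rewrite !mxE.
have eL : eps * (L * a ord0 i) = r * (D * a ord0 i).
  by rewrite /eps; field; exact: lt0r_neq0.
rewrite -!mulrA !ltr_pM2l// !mulrDl !mul1r mulNr eL.
rewrite -mulrN !ltrD2l !ltr_pM2l//.
by rewrite -ltr_norml.
Qed.

Lemma count_small t f u : F f -> 0 <= t -> 0 < u -> t * (1 + eps) <= u ->
  (3 * count_ge Q L u (cone_point t f) < n)%N.
Proof.
move=> [Qf _] t0 u0 tu; apply: leq_ltn_trans (card_large_coord_body bQ uQ nQ Qf n0).
rewrite leq_mul2l /=; apply/subset_leq_card/fintype.subsetP => i.
rewrite !inE => h; rewrite leNgt; apply/negP => fi.
have La : 0 < L * a ord0 i by rewrite mulr_gt0.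
have [tz|tn] := eqVneq t 0.
  move: h; rewrite tz /cone_point scale0r [X in _ <= X]mxE; apply/negP; rewrite -ltNge.
  by rewrite -mulrA mulr_gt0.
have tp : 0 < t by rewrite lt_neqAle eq_sym tn.
have /andP[_ h2] := cone_point_small fi tp.
have := le_lt_trans h h2; rewrite -mulrA ltr_pM2r//.
by rewrite ltNge tu.
Qed.

Lemma count_big t f u : F f -> 0 < t -> u <= t * (1 - eps) ->
  (3 * (n - count_ge Q L u (cone_point t f)) < n)%N.
Proof.
move=> [Qf _] t0 ut; apply: leq_ltn_trans (card_large_coord_body bQ uQ nQ Qf n0).
rewrite leq_mul2l /= -[X in (X - _)%N](card_ord n).
rewrite -(cardC [pred i | (u * L * a ord0 i <= cone_point t f ord0 i)%R]).
rewrite /count_ge addKn; apply/subset_leq_card/fintype.subsetP => i.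
rewrite !inE => h; rewrite leNgt; apply: contra h => fi.
have La : 0 < L * a ord0 i by rewrite mulr_gt0.
have /andP[h2 _] := cone_point_small fi t0.
by apply: le_trans (ltW h2); rewrite -mulrA ler_pM2r.
Qed.

Lemma count_scale c u x : 0 < c -> count_ge Q L (c * u) (c *: x) = count_ge Q L u x.
Proof.
move=> c0; apply: eq_card => i; rewrite !inE [X in (_ <= X) = _]mxE.
by rewrite -!mulrA ler_pM2l.
Qed.

End counting.

End cone_geometry.

(** * Sublevel sets of the counting function and their boundaries *)

Section measurability.
Variables (R : realType) (n : nat).
Implicit Types (K G : set 'rV[R]_n).

Lemma compact_measurable_rV G : compact G -> measurable G.
Proof.
move=> cG; apply: closed_measurable_rV; apply: compact_closed cG.
exact: norm_hausdorff.
Qed.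

Definition erase_coord (i : 'I_n) (x : 'rV[R]_n) : 'rV[R]_n :=
  x - x ord0 i *: delta_mx ord0 i.

Lemma erase_coordE i (x : 'rV[R]_n) j :
  erase_coord i x ord0 j = if j == i then 0 else x ord0 j.
Proof.
rewrite !mxE eqxx /=; case: eqP => [->|_]; first by rewrite mulr1 subrr.
by rewrite mulr0 subr0.
Qed.

Lemma erase_coord_continuous i : continuous (erase_coord i).
Proof.
move=> x; apply: (continuousB (f := id)
  (g := fun y : 'rV[R]_n => y ord0 i *: (delta_mx ord0 i : 'rV[R]_n))).
  exact: cvg_id.
apply: (continuousZ (s := fun y : 'rV[R]_n => y ord0 i)
  (f := fun=> (delta_mx ord0 i : 'rV[R]_n))); first exact: coord_continuous.
exact: cst_continuous.
Qed.

(* The boundary involves projections of sets along coordinate lines, which need not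
   preserve Borel sets; they do preserve sigma-compact ones. *)
Lemma measurable_coord_boundary K (G : nat -> set 'rV[R]_n) :
  measurable K -> (forall j, compact (G j)) ->
  measurable (coord_boundary K (\bigcup_j G j)).
Proof.
move=> mK cG.
have mS : measurable (\bigcup_j G j).
  by apply: bigcupT_measurable => j; exact: compact_measurable_rV.
pose E i j := erase_coord i @^-1` (erase_coord i @` G j).
have mE i j : measurable (E i j).
  apply: closed_measurable_rV; apply: closed_comp.
    by move=> x _; exact: erase_coord_continuous.
  apply: compact_closed; first exact: norm_hausdorff.
  apply: continuous_compact (cG j).
  by apply: continuous_subspaceT => x; exact: erase_coord_continuous.
have [n0|n0] := posnP n.
  have allI (x y : 'rV[R]_n) : x = y.
    by apply/rowP => i; exfalso; move: (ltn_ord i); rewrite {2}n0.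
  rewrite (_ : coord_boundary _ _ = set0)//; apply/seteqP; split=> // y [_ Sy [x Sx _]].
  by apply: Sy; rewrite (allI y x).
have -> : coord_boundary K (\bigcup_j G j) =
    K `&` ~` (\bigcup_j G j) `&` \big[setU/set0]_(i < n) \bigcup_j E i j.
  apply/seteqP; split=> y.
    move=> [Ky Sy [x [j _ Gx] xy]]; split; first by split.
    have [i Hi] : exists i, forall k, k != i -> x ord0 k = y ord0 k.
      have [[i /= xi]|nx] := pselect (exists i, x ord0 i != y ord0 i).
        exists i => k ki; apply/eqP; apply: contraT => xk.
        move/card_le1_eqP: xy => /(_ k i); rewrite !inE xk xi => /(_ isT isT) e.
        by rewrite e eqxx in ki.
      exists (Ordinal n0) => k _; apply/eqP; apply: contraT => xk.
      by exfalso; apply: nx; exists k.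
    rewrite -bigcup_seq; exists i; first by rewrite /= mem_index_enum.
    exists j => //; exists x => //; apply/rowP => k; rewrite !erase_coordE.
    by case: eqP => // /eqP /Hi.
  move=> [[Ky Sy]]; rewrite -bigcup_seq => -[i _ [j _ [x Gx xy]]]; split=> //.
  exists x; first by exists j.
  apply: (@leq_trans #|pred1 i|); last by rewrite card1.
  apply/subset_leq_card/fintype.subsetP => k.
  rewrite !inE; apply: contraR => ki.
  by have /rowP/(_ k) := xy; rewrite !erase_coordE (negbTE ki) => ->.
apply: measurableI; first by apply: measurableI => //; exact: measurableC.
by apply: bigsetU_measurable => i _; exact: bigcupT_measurable.
Qed.

End measurability.

Section levels.
Variables (R : realType) (n : nat) (Q : set 'rV[R]_n) (lhat : {scalar 'rV[R]_n}).
Hypotheses (bQ : convex_body Q) (uQ : unconditional Q) (nQ : norming Q lhat).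
Variables (L r : R).
Hypotheses (r0 : 0 < r) (rL : r <= L) (n0 : (0 < n)%N).
Local Notation a := (apex Q).
Local Notation K := (diagonal_cone Q lhat L r).

Definition cone_level (m : nat) (u : R) : set 'rV[R]_n :=
  [set x | K x /\ (count_ge Q L u x <= m)%N].

Lemma cone_level_sigma_compact m u : exists G : nat -> set 'rV[R]_n,
  (forall j, compact (G j)) /\ cone_level m u = \bigcup_j G j.
Proof.
pose P (I : {set 'I_n}) (k : nat) : set 'rV[R]_n :=
  K `&` \bigcap_(i in [set i | i \notin I])
    [set x : 'rV[R]_n | x ord0 i <= u * L * a ord0 i - k.+1%:R^-1].
have cK : compact K by exact: cone_compact.
have clK : closed K by apply: (compact_closed _ cK); exact: norm_hausdorff.
have cP I k : compact (P I k).
  apply: subclosed_compact cK _; last by move=> x [].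
  apply: closedI => //.
  apply: closed_bigI => i _.
  apply: (@closed_comp _ _ (fun x : 'rV[R]_n => x ord0 i)
    [set y | y <= u * L * a ord0 i - k.+1%:R^-1]).
    by move=> x _; exact: coord_continuous.
  exact: closed_le.
exists (fun j => if (unpickle j : option ({set 'I_n} * nat)) is Some Ik then
    if (#|Ik.1| <= m)%N then P Ik.1 Ik.2 else set0 else set0).
split=> [j|].
  case: unpickle => [Ik|]; last exact: compact0.
  by case: ifP => _; [exact: cP|exact: compact0].
apply/seteqP; split=> x.
  move=> [Kx Nx].
  pose I : {set 'I_n} := finset (fun i => u * L * a ord0 i <= x ord0 i).
  have [k Hk] : exists k : nat, forall i, i \notin I -> x ord0 i <= u * L * a ord0 i - k.+1%:R^-1.
    pose dl i := u * L * a ord0 i - x ord0 i.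
    exists (Num.truncn (\sum_(i | 0 < dl i) (dl i)^-1)) => i.
    rewrite inE -ltNge -subr_gt0 -/(dl i) => di.
    rewrite lerBrDl -lerBrDr -/(dl i) invf_ple ?posrE ?ltr0n//.
    apply/ltW; apply: le_lt_trans (truncnS_gt _).
    by rewrite (bigD1 i)//= lerDl sumr_ge0// => j /andP[/ltW dj _]; rewrite invr_ge0.
  exists (pickle (I, k)) => //; rewrite pickleK /=.
  rewrite (_ : #|I| = count_ge Q L u x); last by apply: eq_card => i; rewrite !inE.
  by rewrite Nx; split=> // i /= iI; exact: Hk.
move=> [j _]; case: unpickle => // -[I k] /=; case: ifP => // Im [Kx Hx]; split=> //.
apply: leq_trans Im; apply/subset_leq_card/fintype.subsetP => i; rewrite inE => ci.
apply: contraT => iI; have := Hx i iI; rewrite /= => /(le_trans ci).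
by rewrite lerBrDl gerDr leNgt invr_gt0 ltr0n.
Qed.

Lemma measurable_cone_level m u : measurable (cone_level m u).
Proof.
have [G [cG ->]] := cone_level_sigma_compact m u.
by apply: bigcupT_measurable => j; exact: compact_measurable_rV.
Qed.

Lemma measurable_level_boundary m u : measurable (coord_boundary K (cone_level m u)).
Proof.
have [G [cG ->]] := cone_level_sigma_compact m u.
apply: measurable_coord_boundary => //.
apply: compact_measurable_rV; exact: cone_compact.
Qed.

Lemma coord_boundary_sub m u :
  coord_boundary K (cone_level m u) `<=` cone_level m.+1 u `\` cone_level m u.
Proof.
move=> y [Ky Sy [x [Kx Nx] xy]]; split=> //; split=> //.
rewrite -addn1; apply: leq_trans (leq_add Nx xy); rewrite /count_ge.
rewrite -cardUI; apply: leq_trans (leq_addr _ _).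
apply/subset_leq_card/fintype.subsetP => i; rewrite !inE => yi.
by case: eqVneq => [->|_]; rewrite ?orbT// orbF.
Qed.

Local Notation eps := (order_const R * r / L).

(* Below height 1 - eps the truncation t <= 1 of the cone is not felt, so that the
   sublevel sets are dilates of each other. *)
Lemma cone_level_scale m c : eps < 1 -> (3 * m <= 2 * n)%N -> 0 < c -> c <= 1 ->
  cone_level m (c * (1 - eps)) = [set c *: x | x in cone_level m (1 - eps)].
Proof.
move=> e1 mn c0 c1; have cn0 : c != 0 by exact: lt0r_neq0.
apply/seteqP; split=> x; last first.
  move=> [y [Ky Ny] <-]; split; last by rewrite count_scale.
  by apply: cone_star => //; exact: ltW.
move=> [Kx Nx]; move: (Kx); rewrite coneE// => -[t [f [t0 t1 Ff xE]]].
have tc : t < c.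
  rewrite ltNge; apply/negP => ct.
  have := count_big bQ uQ nQ r0 rL n0 (u := c * (1 - eps)) Ff (lt_le_trans c0 ct).
  rewrite ler_pM2r ?subr_gt0// => /(_ ct); rewrite -xE; lia.
exists (c^-1 *: x); last by rewrite scalerA mulfV ?scale1r.
split; last by rewrite -(count_scale _ _ _ _ c0) scalerA mulfV ?scale1r.
rewrite coneE//; exists (c^-1 * t), f; split=> //.
- by rewrite mulr_ge0// invr_ge0 ltW.
- by rewrite mulrC ler_pdivrMr// mul1r ltW.
- by rewrite xE /cone_point scalerA.
Qed.

Lemma cone_level_large m : eps < 1 -> (n <= 3 * m.+1)%N ->
  [set (1 - eps) / (1 + eps) *: x | x in K] `<=` cone_level m (1 - eps).
Proof.
move=> e1 nm _ [x Kx <-].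
have e0 : 0 < eps.
  by rewrite divr_gt0 ?mulr_gt0//; [exact: lt_le_trans (order_const_ge1 R)|exact: lt_le_trans rL].
have c0 : 0 <= (1 - eps) / (1 + eps) by rewrite divr_ge0; lra.
have c1 : (1 - eps) / (1 + eps) <= 1 by rewrite ler_pdivrMr; lra.
split; first exact: cone_star.
move: Kx; rewrite coneE// => -[t [f [t0 t1 Ff ->]]].
have -> : (1 - eps) / (1 + eps) *: cone_point Q L r t f =
    cone_point Q L r ((1 - eps) / (1 + eps) * t) f by rewrite /cone_point scalerA.
rewrite -ltnS -(ltn_pmul2l (m := 3))//; apply: leq_trans nm.
apply: (count_small bQ uQ nQ r0 rL n0 Ff); [exact: mulr_ge0|by rewrite subr_gt0|].
rewrite mulrAC divfK; last by rewrite gt_eqF// ltr_wpDr// ltW.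
by rewrite ler_piMr// subr_ge0 ltW.
Qed.

End levels.

(** * Volumes *)

Section volumes.
Variables (R : realType) (n : nat).
Local Notation mu := (lebesgue_rV R n).

Lemma vol_dilate c (A : set 'rV[R]_n) : 0 < c -> measurable A ->
  vol [set c *: x | x in A] = c ^+ n * vol A.
Proof.
move=> c0 mA; rewrite /vol lebesgue_rV_scale//.
by case: (mu A) => [x| |]; rewrite ?mulr0//= ?gt0_muley ?gt0_muleNy ?lte_fin ?exprn_gt0.
Qed.

Lemma vol_le (A B : set 'rV[R]_n) M : measurable A -> measurable B ->
  B `<=` rV_cube M -> A `<=` B -> vol A <= vol B.
Proof.
move=> mA mB BM AB; rewrite fine_le//.
- exact: (@cube_fin_num _ _ _ M mA (subset_trans AB BM)).
- exact: (@cube_fin_num _ _ _ M mB BM).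
- by apply: le_measure; rewrite ?inE.
Qed.

Lemma vol_setD (A B : set 'rV[R]_n) M : measurable A -> measurable B ->
  A `<=` rV_cube M -> B `<=` A -> vol (A `\` B) = vol A - vol B.
Proof.
move=> mA mB AM BA.
have fA := cube_fin_num mA AM; have fB := cube_fin_num mB (subset_trans BA AM).
rewrite /vol measureD//; last by rewrite -ge0_fin_numE.
by rewrite setIidr// fineB.
Qed.

End volumes.

Lemma ratio_pigeonhole (R : realType) (V : nat -> R) (rho : R) (m0 j n : nat) :
  1 <= rho -> 0 < V m0 -> (0 < j)%N -> (n <= 4 * j)%N ->
  V (m0 + j)%N <= rho ^+ n * V m0 ->
  exists2 i, (i < j)%N & V (m0 + i).+1 <= rho ^+ 4 * V (m0 + i)%N.
Proof.
move=> rho1 V0 j0 nj Vj; apply: contrapT => nex.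
have rho0 : 0 < rho by exact: lt_le_trans rho1.
have grow i : (i < j)%N -> rho ^+ 4 * V (m0 + i)%N < V (m0 + i).+1.
  by move=> ij; rewrite ltNge; apply/negP => h; apply: nex; exists i.
have key i : (i < j)%N -> rho ^+ (4 * i.+1) * V m0 < V (m0 + i.+1)%N.
  elim: i => [|i IH] ij; first by have := grow _ ij; rewrite addn0 addn1 muln1.
  rewrite [(m0 + _)%N]addnS; apply: lt_trans (grow _ ij).
  rewrite mulnS exprD -mulrA ltr_pM2l ?exprn_gt0//.
  exact/IH/ltnW.
case: j j0 nj Vj key {nex grow} => // j _ nj Vj /(_ j (ltnSn j)).
apply/negP; rewrite -leNgt (le_trans Vj)// ler_wpM2r//; first exact: ltW.
exact: ler_weXn2l.
Qed.

Lemma middle_third n : (5 <= n)%N -> exists m j, [/\ (0 < j)%N, (n <= 4 * j)%N,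
  (n <= 3 * m.+1)%N & forall i, (i < j)%N -> (3 * (m + i).+1 <= 2 * n)%N].
Proof.
move=> n5; exists ((n + 2) %/ 3).-1, ((2 * n) %/ 3 - ((n + 2) %/ 3).-1)%N.
by split=> [|||i ij]; lia.
Qed.

Lemma ratio_bound (R : realType) (e : R) : 0 <= e -> e <= 1 / 2 ->
  ((1 + e) / (1 - e)) ^+ 4 - 1 <= 160 * e.
Proof.
move=> e0 e1.
have e1' : 0 < 1 - e by lra.
have h : (1 + e) / (1 - e) <= 1 + 4 * e.
  rewrite ler_pdivrMr//.
  have : 0 <= 2 * e * (1 - 2 * e) by rewrite mulr_ge0; lra.
  lra.
have h0 : 0 <= (1 + e) / (1 - e) by rewrite divr_ge0; lra.
have : ((1 + e) / (1 - e)) ^+ 4 <= (1 + 4 * e) ^+ 4.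
  by rewrite ler_pXn2r ?nnegrE//; lra.
suff : (1 + 4 * e) ^+ 4 - 1 <= 160 * e by lra.
have e2 : e ^+ 2 <= e / 2 by rewrite expr2 ler_wpM2l//; lra.
have e3 : e ^+ 3 <= e / 4.
  rewrite exprS (le_trans (ler_wpM2l e0 e2))//; move: e2; rewrite expr2; lra.
have e4 : e ^+ 4 <= e / 8.
  rewrite exprS (le_trans (ler_wpM2l e0 e3))//; move: e2; rewrite expr2; lra.
have -> : (1 + 4 * e) ^+ 4 - 1 = 16 * e + 96 * e ^+ 2 + 256 * e ^+ 3 + 256 * e ^+ 4 by ring.
lra.
Qed.

Section cone_volumes.
Variables (R : realType) (n : nat) (Q : set 'rV[R]_n) (lhat : {scalar 'rV[R]_n}).
Hypotheses (bQ : convex_body Q) (uQ : unconditional Q) (nQ : norming Q lhat).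
Variables (L r : R).
Hypotheses (r0 : 0 < r) (rL : r <= L).
Local Notation K := (diagonal_cone Q lhat L r).

Lemma cone_bounded : exists M, K `<=` rV_cube M.
Proof.
have [M [d [d0 QM dQ]]] := body_bounds bQ uQ.
exists ((L + r) * M) => x /(cone_sub bQ uQ nQ r0 rL)[y Qy <-] i.
have Lr : 0 <= L + r by rewrite addr_ge0// ltW// (lt_le_trans r0).
by rewrite mxE normrM ger0_norm// ler_wpM2l// QM.
Qed.

Lemma measurable_cone : measurable K.
Proof. apply: compact_measurable_rV; exact: cone_compact. Qed.

Lemma vol_cone_gt0 : 0 < vol K.
Proof.
have [M KM] := cone_bounded; have [M' [d [d0 QM dQ]]] := body_bounds bQ uQ.
pose lo i := L / 2 * apex Q ord0 i - r / 8 * d.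
pose hi i := L / 2 * apex Q ord0 i + r / 8 * d.
have rd : 0 < r / 8 * d by rewrite mulr_gt0// divr_gt0.
have lohi i : lo i < hi i by rewrite /lo /hi; lra.
have BK : rV_box (fun i => `[lo i, hi i]%classic) `<=` K.
  move=> x Bx; apply: (cone_contains_translate bQ uQ nQ r0 rL).
  exists ((r / 8)^-1 *: (x - (L / 2) *: apex Q)); last first.
    by rewrite scalerA mulfV ?scale1r ?subrKC// lt0r_neq0// divr_gt0.
  apply: dQ => i; have := Bx i; rewrite /= in_itv/= /lo /hi => /andP[h1 h2].
  move: (apex Q) h1 h2 => b h1 h2; rewrite !mxE.
  rewrite normrM gtr0_norm ?invr_gt0 ?divr_gt0// mulrC ler_pdivrMr ?divr_gt0//.
  by rewrite mulrC ler_norml; apply/andP; split; lra.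
have mB : measurable (rV_box (fun i => `[lo i, hi i]%classic)).
  by apply: measurable_rV_box => i; exact: measurable_itv.
apply: lt_le_trans (vol_le mB measurable_cone KM BK).
rewrite /vol lebesgue_rV_box_itv/= => [|i]; last exact: ltW.
by apply: prodr_gt0 => i _; rewrite subr_gt0.
Qed.

Hypothesis n5 : (5 <= n)%N.
Local Notation eps := (order_const R * r / L).
Hypothesis eps_le : eps <= 1 / 2.

Let n0 : (0 < n)%N. Proof. exact: leq_trans n5. Qed.
Let L0 : 0 < L. Proof. exact: lt_le_trans rL. Qed.
Let eps_gt0 : 0 < eps.
Proof.
by rewrite divr_gt0// mulr_gt0//; exact: lt_le_trans (order_const_ge1 R).
Qed.
Let eps_lt1 : eps < 1. Proof. by apply: le_lt_trans eps_le _; lra. Qed.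
Let u0 := 1 - eps.
Let u0_gt0 : 0 < u0. Proof. by rewrite subr_gt0. Qed.
Let rho := (1 + eps) / (1 - eps).
Let rho_gt0 : 0 < rho. Proof. by rewrite divr_gt0// addr_gt0. Qed.

Let V m := vol (cone_level Q lhat L r m u0).

Let level_sub m u : cone_level Q lhat L r m u `<=` K. Proof. by move=> x []. Qed.

Let V_ge m : (n <= 3 * m.+1)%N -> vol K <= rho ^+ n * V m.
Proof.
move=> nm; have [M KM] := cone_bounded.
have c0 : 0 < (1 - eps) / (1 + eps) by rewrite divr_gt0// addr_gt0.
have sub := cone_level_large bQ uQ nQ r0 rL n0 eps_lt1 nm.
have mS : measurable [set (1 - eps) / (1 + eps) *: x | x in K].
  have cK : compact K by exact: cone_compact.
  apply: compact_measurable_rV; apply: (continuous_compact _ cK).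
  by apply: continuous_subspaceT => x; exact: scaler_continuous.
have := vol_le mS (measurable_cone_level bQ uQ nQ L r m u0)
  (subset_trans (@level_sub m u0) KM) sub.
rewrite vol_dilate//; last exact: measurable_cone.
rewrite -(ler_pM2l (exprn_gt0 n rho_gt0)) mulrA -exprMn.
have -> : rho * ((1 - eps) / (1 + eps)) = 1.
  rewrite /rho mulf_div [X in _ / X]mulrC divff//.
  by rewrite lt0r_neq0// mulr_gt0// addr_gt0.
by rewrite expr1n mul1r.
Qed.

Lemma cone_isoperimetric_defect s : 0 < s -> s <= expR (- (2 * n%:R)) ->
  exists m u, [/\ (n <= 3 * m.+1)%N, (3 * m.+1 <= 2 * n)%N, 0 < u,
    vol (cone_level Q lhat L r m u) / vol K = s &
    vol (coord_boundary K (cone_level Q lhat L r m u)) / vol (cone_level Q lhat L r m u)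
      <= 160 * eps].
Proof.
move=> s0 sn; have [M KM] := cone_bounded; have K0 := vol_cone_gt0.
have mlev m u : measurable (cone_level Q lhat L r m u) by exact: measurable_cone_level.
have [m0 [j [j0 nj nm0 mj]]] := middle_third n5.
have rhon : 0 < rho ^+ n by rewrite exprn_gt0.
have V0 m : (n <= 3 * m.+1)%N -> 0 < V m.
  by move=> /V_ge h; have := lt_le_trans K0 h; rewrite pmulr_rgt0.
have rho1 : 1 <= rho by rewrite ler_pdivlMr ?subr_gt0// mul1r; have := eps_gt0; lra.
have Vj : V (m0 + j)%N <= rho ^+ n * V m0.
  apply: le_trans (V_ge nm0).
  exact: vol_le (mlev _ _) measurable_cone KM (@level_sub _ _).
have [i ij Vi] := ratio_pigeonhole rho1 (V0 _ nm0) j0 nj Vj.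
pose m := (m0 + i)%N.
have nm : (n <= 3 * m.+1)%N.
  by apply: leq_trans nm0 _; rewrite leq_mul2l ltnS leq_addr.
have mn : (3 * m.+1 <= 2 * n)%N by exact: mj.
have Vm := V0 _ nm.
pose x := s * vol K / V m.
have x0 : 0 < x by rewrite divr_gt0// mulr_gt0.
pose c := x `^ (n%:R^-1).
have c0 : 0 < c by exact: powR_gt0.
have cn : c ^+ n = x.
  by rewrite -powR_mulrn ?ltW// -powRrM mulVf ?powRr1 ?ltW// pnatr_eq0 -lt0n.
have c1 : c <= 1.
  rewrite -(@expr_le1 _ n)//; last exact: ltW.
  rewrite cn /x ler_pdivrMr// mul1r.
  apply: le_trans (_ : _ <= s * (rho ^+ n * V m)) _; first by rewrite ler_pM2l// V_ge.
  rewrite mulrA ler_piMl//; first exact: ltW.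
  have rho3 : rho <= 3 by rewrite ler_pdivrMr ?subr_gt0//; move: eps_le; lra.
  have e3 : 3 <= expR 2 :> R by have := expR_ge1Dx (2 : R); lra.
  apply: (@le_trans _ _ (expR (- (2 * n%:R)) * expR 2 ^+ n)).
    apply: ler_pM => //; [exact: ltW|exact: ltW|].
    by apply: lerXn2r; rewrite ?nnegrE ?expR_ge0//; [exact: ltW|exact: le_trans e3].
  by rewrite -expRM_natr -expRD addNr expR0.
exists m, (c * u0).
have scale k : (3 * k <= 2 * n)%N -> vol (cone_level Q lhat L r k (c * u0)) = x * V k.
  move=> kn; rewrite (cone_level_scale bQ uQ nQ r0 rL n0 eps_lt1 kn c0 c1).
  by rewrite vol_dilate// cn.
have mn' : (3 * m <= 2 * n)%N by apply: leq_trans mn; rewrite leq_mul2l leqnSn.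
split=> //.
- exact: mulr_gt0.
- by rewrite scale// /x divfK ?gt_eqF// mulfK// gt_eqF.
rewrite ler_pdivrMr; last by rewrite scale// mulr_gt0.
have bsub := @coord_boundary_sub R n Q lhat L r m (c * u0).
have lsub : cone_level Q lhat L r m (c * u0) `<=` cone_level Q lhat L r m.+1 (c * u0).
  by move=> y [Ky Ny]; split=> //; exact: leqW.
apply: (@le_trans _ _ (vol (cone_level Q lhat L r m.+1 (c * u0) `\`
    cone_level Q lhat L r m (c * u0)))).
  apply: (@vol_le _ _ _ _ M) => //.
  - exact: measurable_level_boundary.
  - exact: measurableD.
  - by move=> y [[Ky _] _]; exact: KM.
rewrite (@vol_setD _ _ _ _ M)//; last by move=> y [Ky _]; exact: KM.
rewrite !scale// -mulrBr mulrCA ler_pM2l//.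
have := ratio_bound (ltW eps_gt0) eps_le; rewrite -/rho => rb.
rewrite lerBlDr; apply: le_trans Vi _; rewrite -[X in _ + X]mul1r -mulrDl.
by rewrite ler_pM2r// -lerBlDr.
Qed.

End cone_volumes.

Theorem proposition1p5 (R : realType) :
  exists C0 C1 C : R, [/\ 0 < C0, 0 < C1, 0 < C &
    forall (n : nat) (Q : set 'rV[R]_n) (lhat : {scalar 'rV[R]_n}) (r L : R),
      (5 <= n)%N -> convex_body Q -> unconditional Q -> norming Q lhat ->
      0 < r -> C0 * r <= L ->
      let K := diagonal_cone Q lhat L r in
      [/\ [set (L / 2) *: apex Q + (r / 8) *: x | x in Q] `<=` K,
          K `<=` [set (L + r) *: x | x in Q] &
          forall s : R, 0 < s -> s <= expR (- (C1 * n%:R)) ->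
            exists (k : nat) (u : R),
              [/\ Num.ceil (n%:R / 3 : R) <= k%:Z,
                  k%:Z <= Num.floor (2 * n%:R / 3 : R),
                  0 < u &
                  let A := [set x | K x /\ (count_ge Q L u x <= k - 1)%N] in
                  vol A / vol K = s /\
                  vol (coord_boundary K A) / vol A <= C * r / L]]].
Proof.
pose D := order_const R.
have D1 : 1 <= D by exact: order_const_ge1.
have D0 : 0 < D by exact: lt_le_trans D1.
exists (2 * D), 2, (160 * D); split; [exact: mulr_gt0|by []|exact: mulr_gt0|].
move=> n Q lhat r L n5 bQ uQ nQ r0 DrL K.
have rDr : r <= D * r by rewrite ler_peMl// ltW.
have rL : r <= L by move: r0; lra.
have L0 : 0 < L by exact: lt_le_trans rL.
have epsle : D * r / L <= 1 / 2 by rewrite ler_pdivrMr//; lra.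
split; [exact: cone_contains_translate|exact: cone_sub|move=> s s0 sn].
have [m [u [nm mn u0 volA bd]]] :=
  cone_isoperimetric_defect bQ uQ nQ r0 rL n5 epsle s0 sn.
exists m.+1, u; split=> //.
- by rewrite ceil_le_int ler_pdivrMr// -natrM ler_nat mulnC.
- by rewrite floor_ge_int ler_pdivlMr// -!natrM ler_nat mulnC.
- have -> : [set x | K x /\ (count_ge Q L u x <= m.+1 - 1)%N] = cone_level Q lhat L r m u.
    by rewrite subn1.
  by split; [exact: volA|rewrite -[160 * D * r]mulrA -[_ / L]mulrA].
Qed.
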